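(* Let $a,b,c\in\mathbb{R}$ be such that $a>-1$, $b>-1$ and $c>\max\{0,a-b\}$ and let $\{P_n^{[d]}(x;a,b,c)\}_{n\in\mathbb{N}}$, $d\in\{0,1\}$, be the monic $2$-orthogonal polynomial sequence with respect to $\overline{\mathcal{W}}^{[d]}(x;a,b,c)$. Then $P_n^{[d]}(x;a,b,c)$ has $n$ simple real positive zeros and, if $x_n^{(n)}$ denotes the largest zero of $P_n^{[d]}(x;a,b,c)$, then $$x_n^{(n)}<M\cdot n+o(n),\quad\text{as } n\to+\infty,$$ where $M=\frac32\tau+\beta+\frac{\alpha}{2\tau}\approx3.484$, with $\alpha=\frac{52}{81}$, $\beta=\frac{14}{9}$, $\gamma=\frac{8}{27}$, $\Delta=\gamma^2-\frac{\alpha^3}{27}=\frac{1119104}{14348907}>0$ and $\tau=\sqrt[3]{\gamma+\sqrt{\Delta}}+\sqrt[3]{\gamma-\sqrt{\Delta}}$ (real positive square and cube roots).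
   Context: $\mathbb{N}=\{0,1,2,\dots\}$. For $\alpha>0$, $\beta\in\mathbb{R}$, $x>0$, the Tricomi function is $\mathbf{U}(\alpha,\beta;x)=\frac{1}{\Gamma(\alpha)}\int_0^\infty t^{\alpha-1}(t+1)^{\beta-\alpha-1}e^{-tx}\,dt$. For $a>-1$, $b>-1$, $c>\max\{0,a-b\}$ and $x>0$ define $$\mathcal{W}(x;a,b,c)=\frac{\Gamma(c+b+1)}{\Gamma(a+1)\Gamma(b+1)}\,e^{-x}x^a\,\mathbf{U}(c,a-b+1;x),\qquad \overline{\mathcal{W}}^{[d]}(x;a,b,c)=\begin{bmatrix}\mathcal{W}(x;a,b,c+d)\\ \mathcal{W}(x;a,b,c+1-d)\end{bmatrix},\quad d\in\{0,1\}.$$ A polynomial sequence $\{P_n\}_{n\in\mathbb{N}}$ ($\deg P_n=n$) is $2$-orthogonal with respect to a vector of weights $(w_0,w_1)$ on $(0,\infty)$ if for all $k,n\in\mathbb{N}$: $\int_0^\infty x^kP_n w_0\,dx=0$ if $n\ge 2k+1$ and $\neq0$ if $n=2k$; and $\int_0^\infty x^kP_n w_1\,dx=0$ if $n\ge 2k+2$ and $\neq 0$ if $n=2k+1$. *)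

(* Defs.v *)
From HB Require Import structures.
From mathcomp Require Import all_boot all_order all_algebra.
From mathcomp Require Import all_classical all_reals all_analysis.

Set Implicit Arguments.
Unset Strict Implicit.
Unset Printing Implicit Defensive.

Import Order.TTheory GRing.Theory Num.Theory.
Import numFieldNormedType.Exports.

Local Open Scope classical_set_scope.
Local Open Scope ring_scope.

Section Weights.
Context {R : realType}.

(* All integrals over (0, +oo) are real-valued Lebesgue integrals. *)
Definition integral_pos (f : R -> R) : R :=
  \int[@lebesgue_measure R]_(t in `]0, +oo[) f t.

Definition Gamma (s : R) : R :=
  integral_pos (fun t => t `^ (s - 1) * expR (- t)).

(* Tricomi's confluent hypergeometric function U(al, be; x), for al, x > 0 *)
Definition tricomi (al be x : R) : R :=
  (Gamma al)^-1 *
  integral_pos (fun t =>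
    t `^ (al - 1) * (t + 1) `^ (be - al - 1) * expR (- (t * x))).

Definition weightW (a b c x : R) : R :=
  Gamma (c + b + 1) / (Gamma (a + 1) * Gamma (b + 1)) *
  (expR (- x) * x `^ a * tricomi c (a - b + 1) x).

Definition weight_vec (d : 'I_2) (a b c : R) : (R -> R) * (R -> R) :=
  (weightW a b (c + d%:R), weightW a b (c + 1 - d%:R)).

(* [size (P n) = n.+1] says deg P_n = n. *)
Definition two_orthogonal (w : (R -> R) * (R -> R)) (P : nat -> {poly R}) :
    Prop :=
  [/\ forall n, size (P n) = n.+1,
      forall k n, (2 * k + 1 <= n)%N ->
        integral_pos (fun x => x ^+ k * (P n).[x] * w.1 x) = 0,
      forall k, integral_pos (fun x => x ^+ k * (P (2 * k)%N).[x] * w.1 x) <> 0,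
      forall k n, (2 * k + 2 <= n)%N ->
        integral_pos (fun x => x ^+ k * (P n).[x] * w.2 x) = 0 &
      forall k,
        integral_pos (fun x => x ^+ k * (P (2 * k + 1)%N).[x] * w.2 x) <> 0].

Definition has_simple_positive_zeros (n : nat) (p : {poly R}) : Prop :=
  exists s : seq R, [/\ size s = n, uniq s &
    forall z, z \in s -> [/\ 0 < z, root p z & mup z p = 1%N]].

Definition is_largest_zero (p : {poly R}) (z : R) : Prop :=
  root p z /\ forall y, root p y -> y <= z.

End Weights.

Section Constants.
Variable R : realType.

Definition alphaM : R := 52%:R / 81%:R.
Definition betaM : R := 14%:R / 9%:R.
Definition gammaM : R := 8%:R / 27%:R.
Definition DeltaM : R := gammaM ^+ 2 - alphaM ^+ 3 / 27%:R.

(* [u `^ 3^-1] is the real cube root only for u >= 0; both arguments below are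
   positive because alphaM > 0. *)
Definition tauM : R :=
  (gammaM + Num.sqrt DeltaM) `^ 3%:R^-1 +
  (gammaM - Num.sqrt DeltaM) `^ 3%:R^-1.

Definition constM : R :=
  3%:R / 2%:R * tauM + betaM + alphaM / (2%:R * tauM).

End Constants.

(* Main.v *)
Require Import Defs.
From HB Require Import structures.
From mathcomp Require Import all_boot all_order all_algebra.
From mathcomp Require Import all_classical all_reals all_analysis.
From mathcomp Require Import measurable_realfun zify ring lra.
From mathcomp Require polyrcf.
Set Implicit Arguments.
Unset Strict Implicit.
Unset Printing Implicit Defensive.
Import Order.TTheory GRing.Theory Num.Theory.
Import numFieldNormedType.Exports.
Local Open Scope classical_set_scope.
Local Open Scope ring_scope.

(** The integrals enter only through the moments of the weights.  By Tonelli,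
    the k-th moment of x^a e^(-x) U(c, a-b+1; x) is a constant times
    Gamma(a+k+1) times a beta integral, so that consecutive moments have ratio
    (a+1+k)(b+1+k)/(c+b+1+k) ([weight_moment_rec]).  For such moments the
    orthogonality relations of the monic multiple of
    2F2(-n, e; a+1, b+1; x) are n-th finite differences of polynomials of degree
    less than n, as soon as e - (c+b+1) is a suitable integer
    ([moment_functional_hyp_poly]).  The nonvanishing half of 2-orthogonality
    makes P_n the only monic polynomial of degree n with the vanishing half
    ([two_orthogonal_unique]); hence P_n is the hypergeometric polynomial with
    e = c+b+1+floor((n+d)/2) ([two_orthogonal_stepA]).

    Contiguous relations factor the multiplication by x into three two-term
    steps A_n = B_n + l B_(n-1), B_n = C_n + l' C_(n-1),
    x C_n = A_(n+1) + l'' A_n, where A_n = P_n and all the coefficients are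
    positive; this uses c > 0 and c > a-b.  Along the chain A_0, B_0, C_0, A_1,
    B_1, C_1, ... any three consecutive polynomials have strictly interlacing
    simple positive zeros, since each step preserves this by the intermediate
    value theorem ([interlaced_step]).

    Composing the three steps gives a recurrence
    P_(n+1) = (x - beta_n) P_n - alpha_n P_(n-1) - gamma_n P_(n-2) with
    nonnegative coefficients alpha_n and gamma_n.  The coefficients depend on
    the parity of n; for one constant k and v = n + k those of index up to n are
    at most (14/9) v, (52/81) v^2 and (8/27) v^3.  If
    x >= T + beta + alpha/T + gamma/T^2 for these bounds beta, alpha, gamma,
    then P_(j+1)(x) >= T P_j(x) > 0 for j < n ([recurrence_growth]), so no zero
    of P_n reaches x.  With T = tau v the right-hand side is
    (tau + 14/9 + (52/81)/tau + (8/27)/tau^2) v, which is smallest at the positive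
    root of tau^3 = (52/81) tau + 2 (8/27); Cardano's formula for this root is
    the tau of the statement, and the minimum is the constant M.  Thus the
    largest zero is below M n + M k, an error term that is even bounded. *)

(** * Improper integrals over the positive half-line *)

Section PositiveHalfLine.
Variable R : realType.
Notation mu := (@lebesgue_measure R).
Notation D := (`]0, +oo[%classic : set R).

(** Compact intervals that increase to the half-line.  The factor y makes the
    family stable under the substitution x := y x, see [integral_scale]. *)
Definition exhaust (y : R) (n : nat) : set R := `[y / n.+1%:R, y * n.+1%:R]%classic.

Lemma exhaust_nd y : 0 < y -> nondecreasing_seq (exhaust y).
Proof.
move=> y0; apply/nondecreasing_seqP => n; rewrite subsetEset => x.
rewrite /exhaust /= !in_itv/= => /andP[h1 h2]; apply/andP; split.
  by apply: le_trans h1; rewrite ler_pM2l// lef_pV2 ?posrE// ler_nat.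
by apply: (le_trans h2); rewrite ler_pM2l// ler_nat.
Qed.

Lemma exhaust_sub y n : 0 < y -> exhaust y n `<=` D.
Proof.
move=> y0 x; rewrite /exhaust /= !in_itv/= andbT => /andP[+ _].
by apply: lt_le_trans; rewrite divr_gt0.
Qed.

Lemma exhaust_bigcup y : 0 < y -> \bigcup_n exhaust y n = D.
Proof.
move=> y0; apply/seteqP; split => [x [n _]|x]; first exact: exhaust_sub.
rewrite /= in_itv/= andbT => x0.
pose m := Num.truncn (Num.max (y / x) (x / y)).
have hm : Num.max (y / x) (x / y) < m.+1%:R.
  by rewrite truncnS_gt.
have [h1 h2] : y / x < m.+1%:R /\ x / y < m.+1%:R.
  by split; apply: le_lt_trans hm; rewrite le_max lexx ?orbT.
exists m => //; rewrite /exhaust /= in_itv/=; apply/andP; split.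
  by rewrite ler_pdivrMr// -ler_pdivrMl// mulrC ltW.
by rewrite mulrC -ler_pdivrMr// ltW.
Qed.

Lemma cvg_exhaust (f : R -> R) y : 0 < y -> measurable_fun D f ->
  (forall x : R, 0 < x -> 0 <= f x) ->
  (\int[mu]_(x in exhaust y n) (f x)%:E @[n --> \oo] -->
   \int[mu]_(x in D) (f x)%:E)%E.
Proof.
move=> y0 mf f0; rewrite -(exhaust_bigcup y0).
apply: ge0_nondecreasing_set_cvg_integral.
- exact: exhaust_nd.
- by move=> i; exact: measurable_itv.
- move=> i; apply/measurable_EFinP; apply: measurable_funS mf => //.
  exact: exhaust_sub.
- by move=> i x /(exhaust_sub y0); rewrite /= in_itv/= andbT lee_fin; exact: f0.
Qed.

Lemma measurable_fun_pos (f : R -> R) : {in D, continuous f} -> measurable_fun D f.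
Proof. by move=> cf; apply: open_continuous_measurable_fun => //. Qed.

Lemma exhaust_FTC2 (F f : R -> R) n : {in D, continuous f} ->
  (forall x : R, 0 < x -> is_derive x 1 F (f x)) ->
  (\int[mu]_(x in exhaust 1 n) (f x)%:E = (F (1 * n.+1%:R) - F (1 / n.+1%:R))%:E)%E.
Proof.
move=> cf dF; rewrite /exhaust.
have [->|n0] := eqVneq n 0%N.
  by rewrite !divr1 !mulr1 set_itv1 integral_set1 subrr.
have ab : (1 / n.+1%:R < 1 * n.+1%:R :> R).
  rewrite div1r mul1r (@lt_trans _ _ 1)// ?invf_lt1 ?ltr1n ?ltnS ?lt0n//.
have a0 : (0 < 1 / n.+1%:R :> R) by rewrite divr_gt0.
rewrite EFinB (@continuous_FTC2 _ f F)//.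
- apply: continuous_in_subspaceT => x; rewrite inE /= in_itv/= => /andP[ax _].
  by apply: cf; rewrite inE /= in_itv/= andbT (lt_le_trans a0).
- have cF (x : R) : 0 < x -> {for x, continuous F}.
    by move=> x0; apply: differentiable_continuous; apply/derivable1_diffP; case: (dF x x0).
  split.
  + move=> x; rewrite in_itv/= => /andP[ax _].
    by case: (dF x (lt_trans a0 ax)).
  + apply: cvg_at_right_filter; exact: cF.
  + apply: cvg_at_left_filter; apply: cF; exact: lt_trans ab.
- move=> x; rewrite in_itv/= => /andP[ax _].
  by rewrite derive1E; case: (dF x (lt_trans a0 ax)).
Qed.

Lemma cvg_exhaust_bounds (F : R -> R) (l L : R) :
  F x @[x --> 0^'+] --> l -> F x @[x --> +oo] --> L ->
  F (1 * n.+1%:R) - F (1 / n.+1%:R) @[n --> \oo] --> L - l.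
Proof.
move=> Fl FL; apply: cvgB.
  have /(cvg_pinftyP F L) h := FL; apply: h.
  apply/cvgryPge => r; near=> n; rewrite mul1r.
  by rewrite (@le_trans _ _ n%:R) ?ler_nat//; near: n; exact: nbhs_infty_ger.
have /(cvg_at_rightP F 0 l) h := Fl; apply: h; split.
  by move=> n; rewrite divr_gt0.
rewrite (_ : (fun n => 1 / n.+1%:R) = @harmonic R); first exact: cvg_harmonic.
by apply/funext => n; rewrite div1r.
Unshelve. all: by end_near. Qed.

(** The fundamental theorem of calculus with singularities allowed at both
    ends: the integrands t^(s-1) with s < 1 are not continuous at 0. *)
Lemma integral_ge0_derivative (F f : R -> R) (l L : R) :
  {in D, continuous f} -> (forall x : R, 0 < x -> 0 <= f x) ->
  (forall x : R, 0 < x -> is_derive x 1 F (f x)) ->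
  F x @[x --> 0^'+] --> l -> F x @[x --> +oo] --> L ->
  (\int[mu]_(x in D) (f x)%:E = (L - l)%:E)%E.
Proof.
move=> cf f0 dF Fl FL.
have e1 := cvg_exhaust ltr01 (measurable_fun_pos cf) f0.
rewrite -(cvg_lim _ e1)//; apply/cvg_lim => //.
rewrite (_ : (fun n => _) =
  (fun n => (F (1 * n.+1%:R) - F (1 / n.+1%:R))%:E)); last first.
  by apply/funext => n; exact: exhaust_FTC2.
by apply: cvg_EFin; [exact: nearW|exact: cvg_exhaust_bounds].
Qed.

Lemma integrable_derivative (H h : R -> R) (l L : R) :
  {in D, continuous h} -> (forall x : R, 0 < x -> 0 <= h x) ->
  (forall x : R, 0 < x -> is_derive x 1 H (h x)) ->
  H x @[x --> 0^'+] --> l -> H x @[x --> +oo] --> L ->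
  mu.-integrable D (EFin \o h).
Proof.
move=> ch h0 dH Hl HL; apply/integrableP; split.
  by apply/measurable_EFinP; exact: measurable_fun_pos.
have := integral_ge0_derivative ch h0 dH Hl HL.
under eq_integral => x xD.
  rewrite -(@ger0_norm _ (h x)); last first.
    by apply: h0; move: xD; rewrite inE /= in_itv/= andbT.
  over.
by move=> ->; rewrite ltry.
Qed.

(** Writing f = |f| - (|f| - f) with integrable nonnegative functions on the
    right reduces this to monotone convergence. *)
Lemma cvg_Rintegral_exhaust (f : R -> R) y : 0 < y ->
  mu.-integrable D (EFin \o f) ->
  \int[mu]_(x in exhaust y n) f x @[n --> \oo] --> \int[mu]_(x in D) f x.
Proof.
move=> y0 fi; have /measurable_EFinP mf := measurable_int _ fi.
have ge0_case (g : R -> R) : mu.-integrable D (EFin \o g) ->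
    (forall x : R, 0 < x -> 0 <= g x) ->
    \int[mu]_(x in exhaust y n) g x @[n --> \oo] --> \int[mu]_(x in D) g x.
  move=> gi g0; have /measurable_EFinP mg := measurable_int _ gi.
  apply: fine_cvg; rewrite fineK; first exact: cvg_exhaust.
  exact: integrable_fin_num gi.
have ai : mu.-integrable D (EFin \o (fun x => `|f x|)) by exact: integrable_norm.
have bi : mu.-integrable D (EFin \o (fun x => `|f x| - f x)).
  by apply: eq_integrable (integrableB _ ai fi).
have sub n := @exhaust_sub y n y0.
have -> : \int[mu]_(x in D) f x =
    \int[mu]_(x in D) `|f x| - \int[mu]_(x in D) (`|f x| - f x).
  by rewrite -RintegralB//; apply: eq_Rintegral => x _; rewrite subKr.
rewrite (_ : (fun n => _) = (fun n => \int[mu]_(x in exhaust y n) `|f x| -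
    \int[mu]_(x in exhaust y n) (`|f x| - f x))); last first.
  apply/funext => n; rewrite -RintegralB//.
  - by apply: eq_Rintegral => x _; rewrite subKr.
  - exact: measurable_itv.
  - by apply: integrableS ai => //; exact: measurable_itv.
  - by apply: integrableS bi => //; exact: measurable_itv.
apply: cvgB; apply: ge0_case => // x _.
by rewrite subr_ge0 ler_norm.
Qed.

(** Without a sign condition on f, integrability has to be known beforehand.
    The recurrences of the Gamma and beta integrals are the case l = L. *)
Lemma Rintegral_derivative (F f : R -> R) (l L : R) :
  {in D, continuous f} -> mu.-integrable D (EFin \o f) ->
  (forall x : R, 0 < x -> is_derive x 1 F (f x)) ->
  F x @[x --> 0^'+] --> l -> F x @[x --> +oo] --> L ->
  \int[mu]_(x in D) f x = L - l.
Proof.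
move=> cf fi dF Fl FL.
rewrite -(cvg_lim _ (cvg_Rintegral_exhaust ltr01 fi))//; apply/cvg_lim => //.
rewrite (_ : (fun n => _) = (fun n => F (1 * n.+1%:R) - F (1 / n.+1%:R))).
  exact: cvg_exhaust_bounds.
by apply/funext => n; rewrite /Rintegral (exhaust_FTC2 n cf dF).
Qed.

End PositiveHalfLine.

(** * Gamma and beta integrals *)

Section EulerIntegrals.
Variable R : realType.
Notation mu := (@lebesgue_measure R).
Notation D := (`]0, +oo[%classic : set R).

Lemma integrable_posZl (k : R) (f : R -> R) : mu.-integrable D (EFin \o f) ->
  mu.-integrable D (EFin \o (fun x => k * f x)).
Proof. by move=> fi; apply: eq_integrable (integrableZl _ k fi). Qed.

Lemma integrable_posD (f g : R -> R) : mu.-integrable D (EFin \o f) ->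
  mu.-integrable D (EFin \o g) -> mu.-integrable D (EFin \o (fun x => f x + g x)).
Proof. by move=> fi gi; apply: eq_integrable (integrableD _ fi gi). Qed.

Lemma integrable_posB (f g : R -> R) : mu.-integrable D (EFin \o f) ->
  mu.-integrable D (EFin \o g) -> mu.-integrable D (EFin \o (fun x => f x - g x)).
Proof. by move=> fi gi; apply: eq_integrable (integrableB _ fi gi). Qed.

Lemma integral_posE (f : R -> R) : mu.-integrable D (EFin \o f) ->
  (\int[mu]_(x in D) (f x)%:E = (integral_pos f)%:E)%E.
Proof. by move=> fi; rewrite fineK//; exact: integrable_fin_num fi. Qed.

Lemma powR_split (u x : R) : 0 < x -> x `^ u = x * x `^ (u - 1).
Proof.
move=> x0; rewrite -[in X in _ = X * _](powRr1 (ltW x0)) -powRD.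
  by rewrite addrC subrK.
by rewrite (gt_eqF x0) implybT.
Qed.

(** Primitives of this shape serve twice: with u + v = 0 or u = 0 they give
    integrable majorants, and for general u and v the recurrence of the beta
    integral. *)
Lemma is_derive_powR_powR1 (u v x : R) : 0 < x ->
  is_derive x 1 (fun t => t `^ u * (t + 1) `^ v)
    (x `^ (u - 1) * (x + 1) `^ (v - 1) * (u * (x + 1) + v * x)).
Proof.
move=> x0; have x10 : 0 < x + 1 by rewrite addr_gt0.
have d1 : is_derive x 1 (@powR R ^~ u) (u * x `^ (u - 1)) by exact: is_derive1_powR.
have d2 : is_derive x 1 ((@powR R ^~ v) \o (fun t => t + 1))
    (v * (x + 1) `^ (v - 1) * 1).
  apply: is_derive1_comp; first exact: is_derive1_powR.
  exact: is_derive_shift.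
have d := is_deriveM d1 d2.
rewrite (_ : (fun t => _) = (@powR R ^~ u) * ((@powR R ^~ v) \o (fun t => t + 1)))//.
apply: (is_derive_eq d).
rewrite /= /GRing.scale/= mulr1.
rewrite (powR_split u x0) (powR_split v x10); by ring.
Qed.

Lemma continuous_powR_powR1 (u v : R) :
  {in D, continuous (fun t : R => t `^ u * (t + 1) `^ v)}.
Proof.
move=> x; rewrite inE /= in_itv/= andbT => x0.
apply: differentiable_continuous; apply/derivable1_diffP.
by case: (is_derive_powR_powR1 u v x0).
Qed.

Lemma continuous_powR (v x : R) : 0 < x -> {for x, continuous (@powR R ^~ v)}.
Proof.
move=> x0; apply: differentiable_continuous; apply/derivable1_diffP.
by apply: derivable_powR; rewrite in_itv/= andbT.
Qed.

Lemma cvg_addr1_powR (v : R) : (t + 1) `^ v @[t --> (0 : R)^'+] --> (1 : R).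
Proof.
apply: cvg_at_right_filter.
rewrite [X in _ --> X](_ : 1 = (0 + 1) `^ v); last by rewrite add0r powR1.
apply: (@cvg_comp _ _ _ (fun t : R => t + 1) (@powR R ^~ v) _ (nbhs (0 + 1 : R))).
  by apply: cvgD; [exact: cvg_id|exact: cvg_cst].
by apply: continuous_powR; rewrite add0r.
Qed.

Lemma cvgy_addr1_powRN (q : R) : 0 < q -> (t + 1) `^ (- q) @[t --> +oo] --> (0 : R).
Proof.
move=> q0; under eq_cvg do rewrite powRN.
apply/gtr0_cvgV0.
  by near=> t; rewrite powR_gt0// addr_gt0.
apply/cvgryPge => A; near=> t.
rewrite (@le_trans _ _ (Num.max A 0))// ?le_max ?lexx//.
have m0 : 0 <= Num.max A 0 by rewrite le_max lexx orbT.
have -> : Num.max A 0 = (Num.max A 0 `^ q^-1) `^ q.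
  by rewrite -powRrM mulVf ?gt_eqF// powRr1.
apply: ge0_ler_powR; rewrite ?nnegrE ?powR_ge0 ?(ltW q0)//.
  by rewrite ltW// addr_gt0.
rewrite (@le_trans _ _ t)//; by rewrite lerDl.
Unshelve. all: by end_near. Qed.

(** The integrand is the derivative of (t / (t + 1))^p / p, a bounded function.
    Near 0 it dominates the beta integrand, and everywhere the integrands with
    exponential decay. *)
Lemma integrable_beta_bounded (p : R) : 0 < p ->
  mu.-integrable D (EFin \o (fun t => t `^ (p - 1) * (t + 1) `^ (- p - 1))).
Proof.
move=> p0.
pose H := fun t : R => p^-1 * (t `^ p * (t + 1) `^ (- p)).
apply: (@integrable_derivative _ H (fun t => t `^ (p - 1) * (t + 1) `^ (- p - 1))
  0 (p^-1 * 1)).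
- exact: continuous_powR_powR1.
- by move=> x x0; rewrite mulr_ge0// powR_ge0.
- move=> x x0; have d := is_derive_powR_powR1 p (- p) x0.
  have d' : is_derive x 1 H _ := is_deriveZ p^-1 d; apply: (is_derive_eq d').
  rewrite /GRing.scale/= (_ : p * (x + 1) + - p * x = p); last by ring.
  by rewrite mulrCA mulVf ?mulr1// gt_eqF.
- rewrite [X in _ --> X](_ : 0 = p^-1 * (0 * 1)); last by rewrite mul0r mulr0.
  by apply: cvgMr; apply: cvgM; [exact: powR_cvg0|exact: cvg_addr1_powR].
- apply: cvgMr.
  apply: (@cvg_trans _ ((1 - (t + 1) `^ (-1)) `^ p @[t --> +oo])).
    apply: near_eq_cvg; near=> t.
    have t0 : 0 < t by near: t; apply: nbhs_pinfty_gt; rewrite num_real.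
    have t10 : 0 < t + 1 by rewrite addr_gt0.
    have -> : (t + 1) `^ (- p) = ((t + 1)^-1) `^ p.
      by rewrite -powR_inv1 ?ltW// -powRrM mulN1r.
    rewrite -powRM ?ltW ?invr_gt0//; congr (_ `^ p).
    rewrite powR_inv1 ?ltW//; field.
    by rewrite gt_eqF.
  suff : (1 - (t + 1) `^ (-1)) `^ p @[t --> +oo] --> (1 `^ p : R) by rewrite powR1.
  apply: (@cvg_comp _ _ _ (fun t => 1 - (t + 1) `^ (-1)) (@powR R ^~ p) _ (nbhs (1 : R))).
    suff : 1 - (t + 1) `^ (-1) @[t --> +oo] --> (1 - 0 : R) by rewrite subr0.
    apply: cvgB; first exact: cvg_cst.
    exact: cvgy_addr1_powRN.
  exact: continuous_powR.
Unshelve. all: by end_near. Qed.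

(** The majorant at infinity, derivative of - (t + 1)^(-q) / q. *)
Lemma integrable_addr1_powR (q : R) : 0 < q ->
  mu.-integrable D (EFin \o (fun t => (t + 1) `^ (- q - 1))).
Proof.
move=> q0.
pose H := fun t : R => - q^-1 * (t `^ 0 * (t + 1) `^ (- q)).
apply: (@integrable_derivative _ H (fun t => (t + 1) `^ (- q - 1))
  (- q^-1 * (1 * 1)) (- q^-1 * (1 * 0))).
- move=> x xD; have := @continuous_powR_powR1 0 (- q - 1) x xD.
  by under eq_fun do rewrite powRr0 mul1r.
- by move=> x x0; rewrite powR_ge0.
- move=> x x0; have d := is_derive_powR_powR1 0 (- q) x0.
  have d' : is_derive x 1 _ _ := is_deriveZ (- q^-1) d; apply: (is_derive_eq d').
  rewrite /GRing.scale/= mul0r !add0r.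
  rewrite (_ : x `^ (- 1) = x^-1); last by rewrite powR_inv1// ltW.
  by field; rewrite !gt_eqF.
- apply: cvgMr; under eq_cvg do rewrite powRr0; apply: cvgM; first exact: cvg_cst.
  exact: cvg_addr1_powR.
- apply: cvgMr; under eq_cvg do rewrite powRr0; apply: cvgM; first exact: cvg_cst.
  exact: cvgy_addr1_powRN.
Qed.

(** For an integer n >= max(x, r), the bound e^(tx) = (e^(tx/n))^n
    >= (1 + tx/n)^n >= ((x/n) (1 + t))^n beats (t + 1)^r. *)
Lemma powR_expRN_bounded (r x : R) : 0 < x ->
  exists2 K, 0 <= K & forall t, 0 < t -> (t + 1) `^ r * expR (- (t * x)) <= K.
Proof.
move=> x0; pose n := (Num.truncn (Num.max x r)).+1.
have hn : Num.max x r <= n%:R by rewrite ltW// truncnS_gt.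
have n0 : 0 < n%:R :> R by rewrite ltr0n.
have xn : x <= n%:R by apply: le_trans hn; rewrite le_max lexx.
have rn : r <= n%:R by apply: le_trans hn; rewrite le_max lexx orbT.
exists ((n%:R / x) ^+ n); first by rewrite exprn_ge0// divr_ge0// ltW.
move=> t t0; have t10 : 0 < t + 1 by rewrite addr_gt0.
rewrite expRN ler_pdivrMr ?expR_gt0//.
apply: (@le_trans _ _ ((t + 1) ^+ n)).
  rewrite -powR_mulrn ?(ltW t10)//; apply: ler_powR => //.
  by rewrite lerDr ltW.
have -> : expR (t * x) = expR (t * x / n%:R) ^+ n.
  by rewrite -expRM_natr divfK// gt_eqF.
rewrite -exprMn; apply: lerXn2r; rewrite ?nnegrE ?(ltW t10)//.
  by rewrite mulr_ge0 ?expR_ge0// divr_ge0// ltW.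
apply: (@le_trans _ _ (n%:R / x * (1 + t * x / n%:R))); last first.
  by rewrite ler_pM2l ?divr_gt0// expR_ge1Dx.
rewrite mulrDr mulr1 (_ : n%:R / x * (t * x / n%:R) = t); last first.
  by field; rewrite !gt_eqF.
by rewrite addrC lerD2r ler_pdivlMr// mul1r.
Qed.

Lemma measurable_addr1_powR (r : R) : measurable_fun D (fun t : R => (t + 1) `^ r).
Proof.
apply: measurable_funTS.
apply: (measurableT_comp (f := @powR R ^~ r)); first exact: measurable_powR.
by apply: measurable_funD.
Qed.

Lemma measurable_laplace (c r x : R) : measurable_fun D
  (fun t : R => t `^ (c - 1) * (t + 1) `^ r * expR (- (t * x))).
Proof.
apply: measurable_funM.
  apply: measurable_funM; last exact: measurable_addr1_powR.
  by apply: measurable_funTS; exact: measurable_powR.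
apply: measurable_funTS; apply: measurableT_comp => //.
apply: measurableT_comp => //.
by apply: measurable_funM.
Qed.

Lemma integrable_laplace (c r x : R) : 0 < c -> 0 < x ->
  mu.-integrable D
    (EFin \o (fun t => t `^ (c - 1) * (t + 1) `^ r * expR (- (t * x)))).
Proof.
move=> c0 x0; have [K K0 hK] := powR_expRN_bounded (r + c + 1) x0.
have := integrable_posZl K (integrable_beta_bounded c0).
apply: le_integrable => //.
  by apply/measurable_EFinP; exact: measurable_laplace.
move=> t; rewrite /= in_itv/= andbT => t0; have t10 : 0 < t + 1 by rewrite addr_gt0.
rewrite lee_fin !ger0_norm ?mulr_ge0 ?powR_ge0 ?expR_ge0//.
rewrite mulrCA -mulrA ler_pM2l ?powR_gt0//.
have -> : (t + 1) `^ r = (t + 1) `^ (r + c + 1) * (t + 1) `^ (- c - 1).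
  by rewrite -powRD ?(gt_eqF t10) ?implybT//; congr (_ `^ _); ring.
by rewrite mulrAC ler_pM2r ?powR_gt0// hK.
Qed.

(** Equal to Gamma(c) Gamma(q) / Gamma(c + q); only its recurrence in q
    matters. *)
Definition euler_beta (c q : R) : R :=
  integral_pos (fun t => t `^ (c - 1) * (t + 1) `^ (- q - c)).

(** For t <= 1 the integrand compares with t^(c-1) (t+1)^(-c-1), and for t >= 1
    with (t+1)^(-q-1), because t / (t+1) lies in [1/2, 1]. *)
Lemma integrable_euler_beta (c q : R) : 0 < c -> 0 < q ->
  mu.-integrable D (EFin \o (fun t => t `^ (c - 1) * (t + 1) `^ (- q - c))).
Proof.
move=> c0 q0.
have i1 := integrable_beta_bounded c0.
have i2 := integrable_addr1_powR q0.
have := integrable_posZl 2 (integrable_posD i1 i2).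
apply: le_integrable => //.
  apply/measurable_EFinP; apply: measurable_funM; last exact: measurable_addr1_powR.
  by apply: measurable_funTS; exact: measurable_powR.
move=> t; rewrite /= in_itv/= andbT => t0; have t10 : 0 < t + 1 by rewrite addr_gt0.
rewrite lee_fin !ger0_norm ?mulr_ge0 ?addr_ge0 ?mulr_ge0 ?powR_ge0//.
have [t1|t1] := leP t 1.
  have -> : (t + 1) `^ (- q - c) = (t + 1) `^ (1 - q) * (t + 1) `^ (- c - 1).
    by rewrite -powRD ?(gt_eqF t10) ?implybT//; congr (_ `^ _); ring.
  have h : (t + 1) `^ (1 - q) <= 2.
    apply: (@le_trans _ _ (t + 1)); last by lra.
    by apply: ler1_powR; lra.
  rewrite mulrDr; apply: (@le_trans _ _ (2 * (t `^ (c - 1) * (t + 1) `^ (- c - 1)))).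
    by rewrite mulrCA ler_wpM2r// mulr_ge0// powR_ge0.
  by rewrite lerDl mulr_ge0// powR_ge0.
have -> : t `^ (c - 1) * (t + 1) `^ (- q - c) =
    (t / (t + 1)) `^ (c - 1) * (t + 1) `^ (- q - 1).
  rewrite powRM ?ltW ?invr_gt0// -mulrA; congr (_ * _).
  rewrite -powR_inv1 ?ltW// -powRrM -powRD ?(gt_eqF t10) ?implybT//.
  by congr (_ `^ _); ring.
have u2 : 2^-1 <= t / (t + 1) by rewrite ler_pdivlMr//; lra.
have u1 : t / (t + 1) <= 1 by rewrite ler_pdivrMr//; lra.
have u0 : 0 < t / (t + 1) by rewrite divr_gt0.
have h : (t / (t + 1)) `^ (c - 1) <= 2.
  apply: (@le_trans _ _ ((t / (t + 1)) `^ (- 1))).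
    by apply: ger_powR; [rewrite u0 u1|lra].
  by rewrite powR_inv1 ?(ltW u0)// -[leRHS]invrK lef_pV2 ?posrE// invr_gt0.
rewrite mulrDr; apply: (@le_trans _ _ (2 * (t + 1) `^ (- q - 1))).
  by rewrite ler_wpM2r// powR_ge0.
by rewrite lerDr mulr_ge0// mulr_ge0// powR_ge0.
Qed.

(** Integrate the derivative of t^c (t + 1)^(-q-c), which vanishes at 0 and at
    infinity. *)
Lemma euler_beta_rec (c q : R) : 0 < c -> 0 < q ->
  (c + q) * euler_beta c (q + 1) = q * euler_beta c q.
Proof.
move=> c0 q0; apply/eqP; rewrite -subr_eq0; apply/eqP.
have q10 : 0 < q + 1 by rewrite addr_gt0.
have i1 := integrable_euler_beta c0 q0.
have i2 := integrable_euler_beta c0 q10.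
rewrite /euler_beta /integral_pos -!RintegralZl// -RintegralB//; last 2 first.
  exact: integrable_posZl i2.
  exact: integrable_posZl i1.
transitivity (0 - 0 : R); last by rewrite subrr.
apply: (@Rintegral_derivative _ (fun t => t `^ c * (t + 1) `^ (- q - c))).
- move=> x xD; apply: cvgB; apply: cvgMr; exact: continuous_powR_powR1.
- exact: integrable_posB (integrable_posZl _ i2) (integrable_posZl _ i1).
- move=> x x0; have x10 : 0 < x + 1 by rewrite addr_gt0.
  apply: (is_derive_eq (is_derive_powR_powR1 c (- q - c) x0)).
  rewrite (powR_split (- q - c) x10) (_ : - (q + 1) - c = - q - c - 1); last by ring.
  by ring.
- rewrite [X in _ --> X](_ : 0 = 0 * 1); last by rewrite mul0r.
  apply: cvgM; first exact: powR_cvg0.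
  exact: cvg_addr1_powR.
- apply: (@squeeze_cvgr _ _ _ _ (cst 0) (fun t : R => (t + 1) `^ (- q))).
  + near=> t; have t0 : 0 < t by near: t; apply: nbhs_pinfty_gt; rewrite num_real.
    have t10 : 0 < t + 1 by rewrite addr_gt0.
    rewrite mulr_ge0 ?powR_ge0//= powRB ?(gt_eqF t10) ?implybT//.
    rewrite mulrCA ler_piMr ?powR_ge0// ler_pdivrMr ?powR_gt0// mul1r.
    by apply: ge0_ler_powR; rewrite ?nnegrE ?(ltW t0) ?(ltW t10) ?(ltW c0)// lerDl.
  + exact: cvg_cst.
  + exact: cvgy_addr1_powRN.
Unshelve. all: by end_near. Qed.

Lemma integrable_Gamma (s : R) : 0 < s ->
  mu.-integrable D (EFin \o (fun t => t `^ (s - 1) * expR (- t))).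
Proof.
move=> s0; have := integrable_laplace 0 s0 ltr01.
by apply: eq_integrable => // t _ /=; rewrite powRr0 !mulr1.
Qed.

Lemma continuous_Gamma (s : R) :
  {in D, continuous (fun t : R => t `^ (s - 1) * expR (- t))}.
Proof.
move=> x; rewrite inE /= in_itv/= andbT => x0.
apply: cvgM; first exact: continuous_powR.
apply: (@cvg_comp _ _ _ (fun t : R => - t) (@expR R) _ (nbhs (- x))).
  by apply: cvgN; exact: cvg_id.
exact: continuous_expR.
Qed.

(** Integrate the derivative of t^s e^(-t). *)
Lemma Gamma_rec (s : R) : 0 < s -> Gamma (s + 1) = s * Gamma s.
Proof.
move=> s0; apply/esym/eqP; rewrite -subr_eq0; apply/eqP.
have s10 : 0 < s + 1 by rewrite addr_gt0.
have i1 := integrable_Gamma s0.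
have i2 := integrable_Gamma s10.
rewrite /Gamma /integral_pos -!RintegralZl// -RintegralB//; last first.
  exact: integrable_posZl i1.
transitivity (0 - 0 : R); last by rewrite subrr.
apply: (@Rintegral_derivative _ (fun t => t `^ s * expR (- t))).
- move=> x xD; apply: cvgB; first apply: cvgMr; exact: continuous_Gamma.
- exact: integrable_posB (integrable_posZl _ i1) i2.
- move=> x x0.
  have d1 : is_derive x 1 (@powR R ^~ s) (s * x `^ (s - 1)) by exact: is_derive1_powR.
  have d2 : is_derive x 1 (expR \o -%R) (expR (- x) * -1).
    by apply: is_derive1_comp.
  apply: (is_derive_eq (is_deriveM d1 d2)).
  by rewrite /= /GRing.scale/= addrK; ring.
- rewrite [X in _ --> X](_ : 0 = 0 * expR (- 0)); last by rewrite mul0r.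
  apply: cvgM; first exact: powR_cvg0.
  apply: cvg_at_right_filter.
  apply: (@cvg_comp _ _ _ (fun t : R => - t) (@expR R) _ (nbhs (- 0 : R))).
    by apply: cvgN; exact: cvg_id.
  exact: continuous_expR.
- have [K K0 hK] := powR_expRN_bounded (s + 1) ltr01.
  apply: (@squeeze_cvgr _ _ _ _ (cst 0) (fun t : R => K * (t + 1) `^ (- 1))).
  + near=> t; have t0 : 0 < t by near: t; apply: nbhs_pinfty_gt; rewrite num_real.
    have t10 : 0 < t + 1 by rewrite addr_gt0.
    rewrite mulr_ge0 ?powR_ge0 ?expR_ge0//= powR_inv1 ?(ltW t10)// ler_pdivlMr//.
    apply: le_trans (hK t t0); rewrite mulr1 mulrAC ler_wpM2r ?expR_ge0//.
    rewrite powRD ?(gt_eqF t10) ?implybT// powRr1 ?(ltW t10)// ler_wpM2r ?(ltW t10)//.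
    by apply: ge0_ler_powR; rewrite ?nnegrE ?(ltW t0) ?(ltW t10) ?(ltW s0)// lerDl.
  + exact: cvg_cst.
  + by rewrite -(mulr0 K); apply: cvgMr; exact: cvgy_addr1_powRN.
Unshelve. all: by end_near. Qed.

Lemma integral_scale (f : R -> R) y : 0 < y -> {in D, continuous f} ->
  (forall x : R, 0 < x -> 0 <= f x) ->
  (\int[mu]_(x in D) (f x)%:E = \int[mu]_(x in D) (y * f (y * x))%:E)%E.
Proof.
move=> y0 cf f0.
have cg : {in D, continuous (fun x => y * f (y * x))}.
  move=> x; rewrite inE /= in_itv/= andbT => x0; apply: cvgMr.
  apply: (@cvg_comp _ _ _ (fun t : R => y * t) f _ (nbhs (y * x))).
    by apply: cvgMr; exact: cvg_id.
  by apply: cf; rewrite inE /= in_itv/= andbT mulr_gt0.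
have e1 := cvg_exhaust y0 (measurable_fun_pos cf) f0.
have e2 : (\int[mu]_(x in exhaust 1 n) (y * f (y * x))%:E @[n --> \oo] -->
   \int[mu]_(x in D) (y * f (y * x))%:E)%E.
  apply: (cvg_exhaust ltr01 (measurable_fun_pos cg)) => x x0.
  by rewrite mulr_ge0 ?(ltW y0)//; apply: f0; rewrite mulr_gt0.
rewrite -(cvg_lim _ e1)// -(cvg_lim _ e2)//; congr (limn _); apply/funext => n.
have dy x : ((fun t : R => y * t)^`())%classic x = y.
  rewrite derive1E; have d : is_derive x 1 (fun t : R => y * t) _ := is_deriveZ y (is_derive_id x 1).
  by rewrite (@derive_val _ _ _ _ _ _ _ d) /GRing.scale/= mulr1.
have Dn0 : 0 < n.+1%:R :> R by [].
have -> : exhaust y n = `[y * (1 / n.+1%:R), y * (1 * n.+1%:R)]%classic.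
  by rewrite /exhaust div1r mul1r.
rewrite (@integration_by_substitution_increasing _ (fun t : R => y * t)); first last.
- apply: continuous_in_subspaceT => x; rewrite inE /= in_itv/= => /andP[ax _].
  apply: cf; rewrite inE /= in_itv/= andbT; apply: lt_le_trans ax.
  by rewrite mulr_gt0// divr_gt0.
- split.
  + move=> x _; have d : is_derive x 1 (fun t : R => y * t) _ := is_deriveZ y (is_derive_id x 1).
    by case: d.
  + by apply: cvg_at_right_filter; apply: cvgMr; exact: cvg_id.
  + by apply: cvg_at_left_filter; apply: cvgMr; exact: cvg_id.
- by rewrite (_ : (_^`())%classic = cst y); [exact: is_cvg_cst|apply/funext].
- by rewrite (_ : (_^`())%classic = cst y); [exact: is_cvg_cst|apply/funext].
- by move=> x _; rewrite (_ : (_^`())%classic = cst y); [exact: cst_continuous|apply/funext].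
- by move=> a b _ _ ab; rewrite ltr_pM2l.
- by rewrite div1r mul1r (@le_trans _ _ 1)// ?invf_le1// ler1n.
by apply: eq_integral => x _; rewrite /= fctE /= dy mulrC.
Qed.

Lemma integral_Gamma_scale (s y : R) : 0 < s -> 0 < y ->
  (\int[mu]_(x in D) (x `^ (s - 1) * expR (- (x * y)))%:E = (y `^ (- s) * Gamma s)%:E)%E.
Proof.
move=> s0 y0.
have e := integral_scale y0 (@continuous_Gamma s).
have -> : (\int[mu]_(x in D) (x `^ (s - 1) * expR (- (x * y)))%:E =
  \int[mu]_(x in D) ((y `^ (- s))%:E * (y * ((y * x) `^ (s - 1) * expR (- (y * x))))%:E))%E.
  apply: eq_integral => x; rewrite inE /= in_itv/= andbT => x0.
  rewrite -EFinM powRM ?ltW// [x * y]mulrC; congr (_%:E).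
  rewrite [RHS](_ : _ = (y `^ (- s) * (y * y `^ (s - 1))) *
    (x `^ (s - 1) * expR (- (y * x)))); last by ring.
  rewrite -(powR_split s y0) -powRD; last by rewrite (gt_eqF y0) implybT.
  by rewrite addNr powRr0 mul1r.
rewrite ge0_integralZl ?lee_fin ?powR_ge0//; last 2 first.
- apply/measurable_EFinP; apply: measurable_funM => //.
  apply: measurable_funTS; apply: measurable_funM.
    apply: (measurableT_comp (f := @powR R ^~ (s - 1))); first exact: measurable_powR.
    exact: measurable_funM.
  apply: measurableT_comp => //; exact: measurableT_comp.
- by move=> x; rewrite /= in_itv/= andbT => x0; rewrite lee_fin !mulr_ge0 ?powR_ge0 ?expR_ge0// ltW.
rewrite -e; last by move=> x x0; rewrite mulr_ge0 ?powR_ge0 ?expR_ge0.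
rewrite EFinM; congr (_ * _)%E.
exact: integral_posE (integrable_Gamma s0).
Qed.

End EulerIntegrals.

(** * Moments of the weights *)

Section Moments.
Variable R : realType.
Notation mu := (@lebesgue_measure R).
Notation D := (`]0, +oo[%classic : set R).

(** Tricomi's integral without the factor 1 / Gamma(c), and with a free exponent r
    in place of be - al - 1. *)
Definition laplace (c r x : R) : R :=
  integral_pos (fun t => t `^ (c - 1) * (t + 1) `^ r * expR (- (t * x))).

(** The integrand of the double integral that defines a moment, before the
    order of integration is exchanged. *)
Definition moment_integrand (s c r x t : R) : R :=
  (x `^ (s - 1) * expR (- x)) * (t `^ (c - 1) * (t + 1) `^ r * expR (- (t * x))).

Lemma moment_integrand_ge0 s c r x t : 0 <= moment_integrand s c r x t.
Proof. by rewrite /moment_integrand !mulr_ge0 ?powR_ge0 ?expR_ge0. Qed.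

(** Extended by 0, so that Tonelli's theorem applies on the whole plane. *)
Definition moment_integrandD (s c r : R) (z : measurableTypeR R * measurableTypeR R) :
    \bar R :=
  (\1_D z.1 * \1_D z.2 * moment_integrand s c r z.1 z.2)%:E.

Lemma measurable_moment_integrandD s c r : measurable_fun setT (moment_integrandD s c r).
Proof.
apply/measurable_EFinP.
apply: measurable_funM.
  apply: measurable_funM.
    by apply: measurableT_comp.
  by apply: measurableT_comp.
apply: measurable_funM.
  apply: measurable_funM.
    by apply: (measurableT_comp (f := @powR R ^~ (s - 1))); first exact: measurable_powR.
  apply: measurableT_comp => //; exact: measurableT_comp.
apply: measurable_funM.
  apply: measurable_funM.
    by apply: (measurableT_comp (f := @powR R ^~ (c - 1))); first exact: measurable_powR.
  apply: (measurableT_comp (f := @powR R ^~ r)); first exact: measurable_powR.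
  exact: measurable_funD.
apply: measurableT_comp => //; apply: measurableT_comp => //.
exact: measurable_funM.
Qed.

Lemma moment_integrandD_ge0 s c r z : (0 <= moment_integrandD s c r z)%E.
Proof. by rewrite lee_fin mulr_ge0 ?moment_integrand_ge0// mulr_ge0// indicE. Qed.

Lemma integral_moment_integrand_t s c r x : 0 < c -> 0 < x ->
  (\int[mu]_(t in D) (moment_integrand s c r x t)%:E =
   (x `^ (s - 1) * expR (- x) * laplace c r x)%:E)%E.
Proof.
move=> c0 x0; have i := integrable_laplace r c0 x0.
under eq_integral do rewrite EFinM.
rewrite integralZl//= [in RHS]EFinM; congr (_ * _)%E.
exact: integral_posE i.
Qed.

Lemma integral_moment_integrand_x s c r t : 0 < s -> 0 < t ->
  (\int[mu]_(x in D) (moment_integrand s c r x t)%:E =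
   (Gamma s * (t `^ (c - 1) * (t + 1) `^ (r - s)))%:E)%E.
Proof.
move=> s0 t0; have t10 : 0 < t + 1 by rewrite addr_gt0.
transitivity (\int[mu]_(x in D) ((t `^ (c - 1) * (t + 1) `^ r)%:E *
    (x `^ (s - 1) * expR (- (x * (t + 1))))%:E))%E.
  apply: eq_integral => x _; rewrite -EFinM /moment_integrand; congr (_%:E).
  rewrite (_ : - (x * (t + 1)) = - x + - (t * x)); last by ring.
  by rewrite expRD; ring.
rewrite ge0_integralZl ?lee_fin ?mulr_ge0 ?powR_ge0//; last 2 first.
- apply/measurable_EFinP; apply: measurable_funTS; apply: measurable_funM.
    exact: measurable_powR.
  apply: measurableT_comp => //; apply: measurableT_comp => //.
  exact: measurable_funM.
- by move=> x _; rewrite lee_fin mulr_ge0 ?powR_ge0 ?expR_ge0.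
rewrite integral_Gamma_scale// -EFinM; congr (_%:E).
rewrite (powRD (x := t + 1) (r := r) (s := - s)); first by ring.
by rewrite (gt_eqF t10) implybT.
Qed.

Lemma integral_indic_pos (f : R -> R) : (\int[mu]_x (\1_D x * f x)%:E =
  \int[mu]_(x in D) (f x)%:E)%E.
Proof.
rewrite [RHS]integral_mkcond; apply: eq_integral => x _.
rewrite patchE indicE; case: (x \in D); first by rewrite mul1r.
by rewrite mul0r.
Qed.

(** Integrating over x first gives Gamma(s) (t + 1)^(-s) by scaling, and what
    remains is a beta integral over t. *)
Lemma tonelli_moment s c r : 0 < s -> 0 < c -> 0 < s - r - c ->
  (\int[mu]_(x in D) (x `^ (s - 1) * expR (- x) * laplace c r x)%:E =
   (Gamma s * euler_beta c (s - r - c))%:E)%E.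
Proof.
move=> s0 c0 q0.
have h := fubini_tonelli (m1 := mu) (m2 := mu) (moment_integrandD s c r)
  (measurable_moment_integrandD s c r).
have {h} h := h (fun z => _).
transitivity (\int[mu]_x \int[mu]_t moment_integrandD s c r (x, t))%E.
  rewrite -integral_indic_pos; apply: eq_integral => x _; rewrite indicE.
  have [xD|xD] := boolP (x \in D).
    have x0 : 0 < x by move: xD; rewrite inE /= in_itv/= andbT.
    transitivity (\int[mu]_(t in D) (moment_integrand s c r x t)%:E)%E.
      by rewrite mul1r integral_moment_integrand_t.
    rewrite -integral_indic_pos; apply: eq_integral => t _.
    by rewrite /moment_integrandD /= !indicE xD mul1r.
  rewrite mul0r; apply/esym/integral0_eq => t _.
  by rewrite /moment_integrandD /= indicE (negbTE xD) !mul0r.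
rewrite h; last first.
  exact: moment_integrandD_ge0.
transitivity (\int[mu]_(t in D) (Gamma s * (t `^ (c - 1) * (t + 1) `^ (r - s)))%:E)%E.
  rewrite -integral_indic_pos; apply: eq_integral => t _; rewrite indicE.
  have [tD|tD] := boolP (t \in D).
    have t0 : 0 < t by move: tD; rewrite inE /= in_itv/= andbT.
    transitivity (\int[mu]_(x in D) (moment_integrand s c r x t)%:E)%E; last first.
      by rewrite mul1r integral_moment_integrand_x.
    rewrite -integral_indic_pos; apply: eq_integral => x _.
    by rewrite /moment_integrandD /= !indicE tD mulr1.
  rewrite mul0r; apply: integral0_eq => x _.
  by rewrite /moment_integrandD /= !indicE (negbTE tD) mulr0 !mul0r.
have i := integrable_euler_beta c0 q0.
have e : - (s - r - c) - c = r - s by ring.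
rewrite /euler_beta e in i *.
transitivity ((Gamma s)%:E *
    \int[mu]_(t in D) (t `^ (c - 1) * (t + 1) `^ (r - s))%:E)%E.
  under eq_integral do rewrite EFinM.
  by rewrite integralZl.
rewrite [RHS]EFinM; congr (_ * _)%E.
exact: integral_posE i.
Qed.

(** Tonelli's theorem makes the inner integral of the moment integrand
    measurable; for s = 1 it is e^(-x) times the Laplace integral. *)
Lemma measurable_laplace_fun c r : 0 < c -> measurable_fun D (laplace c r).
Proof.
move=> c0.
have m := measurable_fun_fubini_tonelli_F (m2 := mu) (moment_integrandD 1 c r)
  (measurable_moment_integrandD 1 c r).
have {}m := m (fun z => _).
have h : measurable_fun D
    (fun x : R => fine (\int[mu]_t moment_integrandD 1 c r (x, t))%E).
  apply: measurableT_comp => //; apply: measurable_funTS; apply: m.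
  exact: moment_integrandD_ge0.
have h2 : measurable_fun D
    (fun x : R => expR x * fine (\int[mu]_t moment_integrandD 1 c r (x, t))%E).
  by apply: measurable_funM => //; apply: measurable_funTS.
apply: eq_measurable_fun h2 => x xD.
have x0 : 0 < x by move: xD; rewrite inE /= in_itv/= andbT.
have -> : (\int[mu]_t moment_integrandD 1 c r (x, t) =
    \int[mu]_(t in D) (moment_integrand 1 c r x t)%:E)%E.
  rewrite -integral_indic_pos; apply: eq_integral => t _.
  by rewrite /moment_integrandD /= !indicE xD mul1r.
rewrite integral_moment_integrand_t//= subrr powRr0 mul1r mulrA -expRD subrr expR0 mul1r.
by [].
Qed.

Lemma laplace_ge0 c r x : 0 <= laplace c r x.
Proof.
apply: Rintegral_ge0 => t _.
by rewrite !mulr_ge0 ?powR_ge0 ?expR_ge0.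
Qed.

Lemma integrable_laplace_moment s c r : 0 < s -> 0 < c -> 0 < s - r - c ->
  mu.-integrable D (EFin \o (fun x => x `^ (s - 1) * expR (- x) * laplace c r x)).
Proof.
move=> s0 c0 q0; apply/integrableP; split.
  apply/measurable_EFinP; apply: measurable_funM; last exact: measurable_laplace_fun.
  apply: measurable_funTS; apply: measurable_funM; first exact: measurable_powR.
  exact: measurableT_comp.
rewrite (_ : (\int[_]_(_ in _) _)%E = (Gamma s * euler_beta c (s - r - c))%:E) ?ltry//.
rewrite -tonelli_moment//; apply: eq_integral => x _ /=.
by rewrite ger0_norm// !mulr_ge0 ?powR_ge0 ?expR_ge0 ?laplace_ge0.
Qed.

Lemma laplace_moment s c r : 0 < s -> 0 < c -> 0 < s - r - c ->
  integral_pos (fun x => x `^ (s - 1) * expR (- x) * laplace c r x) =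
  Gamma s * euler_beta c (s - r - c).
Proof. by move=> s0 c0 q0; rewrite /integral_pos /Rintegral tonelli_moment. Qed.

(** Multiplication by x^k shifts the exponent a in the power, not the one
    inside the Tricomi function. *)
Lemma weight_pow (a b c : R) k x : 0 < x -> x ^+ k * weightW a b c x =
  Gamma (c + b + 1) / (Gamma (a + 1) * Gamma (b + 1)) / Gamma c *
  (x `^ (a + k%:R + 1 - 1) * expR (- x) * laplace c (a - b - c) x).
Proof.
move=> x0; rewrite /weightW /tricomi /laplace addrK powRD; last first.
  by rewrite (gt_eqF x0) implybT.
rewrite powR_mulrn ?(ltW x0)//.
rewrite (_ : a - b + 1 - c - 1 = a - b - c); last by ring.
by ring.
Qed.

Definition weight_moment (a b c : R) k : R :=
  integral_pos (fun x => x ^+ k * weightW a b c x).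

Lemma integrable_weight (a b c : R) k : -1 < a -> -1 < b -> 0 < c ->
  mu.-integrable D (EFin \o (fun x => x ^+ k * weightW a b c x)).
Proof.
move=> a1 b1 c0.
have k0 : 0 <= k%:R :> R by [].
have s0 : 0 < a + k%:R + 1 by lra.
have q0 : 0 < a + k%:R + 1 - (a - b - c) - c by lra.
have := integrable_posZl (Gamma (c + b + 1) / (Gamma (a + 1) * Gamma (b + 1)) / Gamma c)
  (integrable_laplace_moment s0 c0 q0).
apply: eq_integrable => // x; rewrite inE /= in_itv/= andbT => x0.
by rewrite weight_pow.
Qed.

(** The k-th moment is a constant times Gamma(a+k+1) times the beta integral
    with parameters c and b+k+1, and both factors satisfy a recurrence. *)
Lemma weight_moment_rec (a b c : R) k : -1 < a -> -1 < b -> 0 < c ->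
  (c + b + 1 + k%:R) * weight_moment a b c k.+1 =
  (a + 1 + k%:R) * (b + 1 + k%:R) * weight_moment a b c k.
Proof.
move=> a1 b1 c0.
have E j : weight_moment a b c j =
    Gamma (c + b + 1) / (Gamma (a + 1) * Gamma (b + 1)) / Gamma c *
    (Gamma (a + j%:R + 1) * euler_beta c (b + j%:R + 1)).
  have j0 : 0 <= j%:R :> R by [].
  have s0 : 0 < a + j%:R + 1 by lra.
  have q0 : 0 < a + j%:R + 1 - (a - b - c) - c by lra.
  rewrite (_ : b + j%:R + 1 = a + j%:R + 1 - (a - b - c) - c); last by ring.
  transitivity (Gamma (c + b + 1) / (Gamma (a + 1) * Gamma (b + 1)) / Gamma c *
      integral_pos (fun x => x `^ (a + j%:R + 1 - 1) * expR (- x) *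
                             laplace c (a - b - c) x)).
    rewrite -(RintegralZl _ _ (integrable_laplace_moment s0 c0 q0))//.
    by apply: eq_Rintegral => x; rewrite inE /= in_itv/= andbT => x0; exact: weight_pow.
  by rewrite (laplace_moment s0 c0 q0).
have k0 : 0 <= k%:R :> R by [].
rewrite !E -!natr1.
have s0 : 0 < a + k%:R + 1 by lra.
have q0 : 0 < b + k%:R + 1 by lra.
have e1 := Gamma_rec s0.
have e2 := euler_beta_rec c0 q0.
rewrite (_ : a + (k%:R + 1) + 1 = a + k%:R + 1 + 1); last by ring.
rewrite (_ : b + (k%:R + 1) + 1 = b + k%:R + 1 + 1); last by ring.
rewrite e1.
set K := _ / _ / _; set G := Gamma _.
transitivity (K * G * (a + k%:R + 1) * ((c + (b + k%:R + 1)) * euler_beta c (b + k%:R + 1 + 1))).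
  by ring.
by rewrite e2; ring.
Qed.

Lemma integral_poly_weight (a b c : R) k (p : {poly R}) : -1 < a -> -1 < b -> 0 < c ->
  integral_pos (fun x => x ^+ k * p.[x] * weightW a b c x) =
  \sum_(i < size p) p`_i * weight_moment a b c (k + i).
Proof.
move=> a1 b1 c0.
have im j := integrable_weight j a1 b1 c0.
have h n : mu.-integrable D
      (EFin \o (fun x => \sum_(i < n) p`_i * (x ^+ (k + i) * weightW a b c x))) /\
    integral_pos (fun x => \sum_(i < n) p`_i * (x ^+ (k + i) * weightW a b c x)) =
    \sum_(i < n) p`_i * weight_moment a b c (k + i).
  elim: n => [|n [IH1 IH2]].
    split.
      by apply: eq_integrable (integrable0 mu D) => // x _ /=; rewrite big_ord0.
    rewrite big_ord0 /integral_pos /Rintegral integral0_eq// => x _.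
    by rewrite big_ord0.
  have e x : \sum_(i < n.+1) p`_i * (x ^+ (k + i) * weightW a b c x) =
     \sum_(i < n) p`_i * (x ^+ (k + i) * weightW a b c x) +
     p`_n * (x ^+ (k + n) * weightW a b c x) by rewrite big_ord_recr.
  have i2 := integrable_posZl p`_n (im (k + n)%N).
  have ef := funext e.
  rewrite ef.
  split; first exact: integrable_posD.
  rewrite /integral_pos RintegralD// big_ord_recr /= -IH2 RintegralZl//.
have [_ <-] := h (size p).
apply: eq_Rintegral => x _; rewrite horner_coef mulr_sumr mulr_suml.
by apply: eq_bigr => i _; rewrite exprD; ring.
Qed.

End Moments.

(** * Hypergeometric polynomials: orthogonality and contiguity *)

Section HypergeometricPolynomials.
Variable R : realFieldType.
Implicit Types (a b c e f : R) (m : nat -> R).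

(** The integral of x^k p against a weight with moments m. *)
Definition moment_functional m k (p : {poly R}) : R :=
  \sum_(i < size p) p`_i * m (k + i)%N.

Lemma moment_functionalE m k (p : {poly R}) n : (size p <= n)%N ->
  moment_functional m k p = \sum_(i < n) p`_i * m (k + i)%N.
Proof.
move=> le_pn; rewrite /moment_functional.
rewrite (big_ord_widen n (fun i => p`_i * m (k + i)%N) le_pn).
rewrite big_mkcond; apply: eq_bigr => i _ /=.
by case: ltnP => // le; rewrite nth_default// mul0r.
Qed.

Lemma moment_functional_lin m k (n : nat) (c : nat -> R) (P : nat -> {poly R}) :
  moment_functional m k (\sum_(j < n) c j *: P j) =
  \sum_(j < n) c j * moment_functional m k (P j).
Proof.
pose N := \max_(j < n) size (P j).
have sP (j : 'I_n) : (size (P j) <= N)%N by exact: leq_bigmax.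
have sS : (size (\sum_(j < n) c j *: P j)%R <= N)%N.
  apply: leq_trans (size_sum _ _ _) _; apply/bigmax_leqP => j _.
  exact: leq_trans (size_scale_leq _ _) (sP j).
rewrite (moment_functionalE _ _ sS).
under eq_bigr do rewrite coef_sum mulr_suml.
rewrite exchange_big /=; apply: eq_bigr => j _.
rewrite (moment_functionalE _ _ (sP j)) mulr_sumr; apply: eq_bigr => i _.
by rewrite coefZ mulrA.
Qed.

Lemma monic_expansion (P : nat -> {poly R}) (p : {poly R}) n :
  (forall j, size (P j) = j.+1) -> (forall j, P j \is monic) -> (size p <= n)%N ->
  exists c : nat -> R, p = \sum_(j < n) c j *: P j.
Proof.
move=> sP mP; elim: n p => [|n IH] p sp.
  by exists (fun _ => 0); rewrite big_ord0; apply/eqP; rewrite -size_poly_leq0.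
have [|c hc] := IH (p - p`_n *: P n).
  apply/leq_sizeP => j; rewrite leq_eqVlt => /orP[/eqP <-|lt_nj].
    rewrite coefB coefZ; have := mP n; rewrite monicE lead_coefE sP /= => /eqP ->.
    by rewrite mulr1 subrr.
  rewrite coefB coefZ (nth_default _ (leq_trans sp lt_nj)).
  by rewrite (nth_default 0 (s := P n)) ?sP// mulr0 subrr.
exists (fun j => if j == n then p`_n else c j).
rewrite big_ord_recr /= eqxx -[LHS](subrK (p`_n *: P n)) hc; congr (_ + _).
by apply: eq_bigr => j _; rewrite ltn_eqF.
Qed.

(** Expand q - P n in the P j with j < n.  Testing against x^0 w1, x^0 w2,
    x^1 w1, x^1 w2, ... kills the coefficients of P 0, P 1, P 2, P 3, ... one after
    the other: all later P j are orthogonal to the test function and P j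
    itself is not. *)
Lemma two_orthogonal_unique m1 m2 (P : nat -> {poly R}) n (q : {poly R}) :
  (forall j, size (P j) = j.+1) -> (forall j, P j \is monic) ->
  (forall k i, (2 * k + 1 <= i)%N -> moment_functional m1 k (P i) = 0) ->
  (forall k, moment_functional m1 k (P (2 * k)%N) <> 0) ->
  (forall k i, (2 * k + 2 <= i)%N -> moment_functional m2 k (P i) = 0) ->
  (forall k, moment_functional m2 k (P (2 * k + 1)%N) <> 0) ->
  size q = n.+1 -> q \is monic ->
  (forall k, (2 * k + 1 <= n)%N -> moment_functional m1 k q = 0) ->
  (forall k, (2 * k + 2 <= n)%N -> moment_functional m2 k q = 0) ->
  P n = q.
Proof.
move=> sP mP o1 n1 o2 n2 sq mq q1 q2.
have [|c qE] := @monic_expansion P (q - P n) n sP mP.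
  apply/leq_sizeP => j; rewrite leq_eqVlt => /orP[/eqP <-|lt_nj].
    rewrite coefB; have := mP n; rewrite monicE lead_coefE sP /= => /eqP ->.
    by have := mq; rewrite monicE lead_coefE sq /= => /eqP ->; rewrite subrr.
  by rewrite coefB !nth_default ?sP ?sq ?subrr.
have vanish m k : moment_functional m k q = 0 -> moment_functional m k (P n) = 0 ->
    \sum_(j < n) c j * moment_functional m k (P j) = 0.
  move=> hq hP; rewrite -moment_functional_lin -qE.
  have s1 : (size (q - P n)%R <= n.+1)%N.
    by rewrite (leq_trans (size_polyD _ _))// size_polyN sq sP maxnn.
  rewrite (moment_functionalE _ _ s1).
  under eq_bigr do rewrite coefB mulrBl.
  rewrite sumrB -moment_functionalE ?sq// -moment_functionalE ?sP//.
  by rewrite hq hP subrr.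
have c0 j : (j < n)%N -> c j = 0.
  elim/ltn_ind: j => j IH lt_jn.
  have single m k : (forall i, (j < i)%N -> moment_functional m k (P i) = 0) ->
      moment_functional m k q = 0 -> moment_functional m k (P j) <> 0 -> c j = 0.
    move=> hi hq hj; have hP := hi n lt_jn.
    have := vanish m k hq hP; rewrite (bigD1 (Ordinal lt_jn))//= big1 ?addr0.
      by move/eqP; rewrite mulf_eq0 => /orP[/eqP//|/eqP].
    move=> i; rewrite -val_eqE /= neq_ltn => /orP[lt_ij|lt_ji].
      by rewrite IH// mul0r.
    by rewrite hi// mulr0.
  have ej := odd_double_half j; rewrite -mul2n in ej.
  case: (odd j) ej => /= ej.
    apply: (single m2 j./2); last by have := n2 j./2; rewrite addnC ej.
      move=> i lt_ji; apply: o2; lia.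
    by apply: q2; lia.
  apply: (single m1 j./2); last by have := n1 j./2; rewrite add0n in ej; rewrite ej.
    move=> i lt_ji; apply: o1; lia.
  by apply: q1; lia.
apply/eqP; rewrite eq_sym -subr_eq0 qE big1// => j _.
by rewrite c0// scale0r.
Qed.

(** The n-th finite difference of a polynomial of degree less than n, given as
    a product of monic linear factors: u0 + j splits the sum into a multiple
    of the same sum for one factor less and, as j C(n, j) = n C(n-1, j-1), a
    multiple of an (n-1)-st difference of the shifted factors. *)
Lemma alternating_sum_prod (us : seq R) n : (size us < n)%N ->
  \sum_(j < n.+1) (-1) ^+ j * 'C(n, j)%:R * \prod_(u <- us) (u + j%:R) = 0.
Proof.
move: {2}(size us) (erefl (size us)) => k; elim: k us n => [|k IH] us n.
  move/size0nil => -> n0; under eq_bigr do rewrite big_nil mulr1.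
  have := exprDn (1 : R) (-1) n; rewrite subrr expr0n; case: n n0 => // n _ /= e.
  rewrite [RHS]e; apply: eq_bigr => i _.
  by rewrite expr1n mul1r mulr_natr.
case/lastP: us => // us u0; rewrite size_rcons => -[sk].
case: n => // n; rewrite ltnS => lt_un.
under eq_bigr => j _ do rewrite -cats1 big_cat big_seq1 /= mulrA.
under eq_bigr => j _ do rewrite mulrDr.
rewrite big_split /=.
have -> : \sum_(j < n.+2) (-1) ^+ j * 'C(n.+1, j)%:R * \prod_(u <- us) (u + j%:R) * u0 = 0.
  by rewrite -mulr_suml IH ?mul0r// ltnW.
rewrite add0r big_ord_recl /= mulr0 add0r.
transitivity (- n.+1%:R * (\sum_(j < n.+1) (-1) ^+ j * 'C(n, j)%:R *
    \prod_(u <- [seq u + 1 | u <- us]) (u + j%:R)) : R); last first.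
  by rewrite IH ?size_map ?mulr0.
rewrite mulr_sumr; apply: eq_bigr => j _; rewrite /bump /= add1n big_map.
have -> : \prod_(u <- us) (u + 1 + j%:R) = \prod_(u <- us) (u + j.+1%:R).
  by apply: eq_bigr => u _; rewrite -natr1; ring.
have := mul_bin_diag n.+1 j; move/(congr1 (fun x => x%:R : R)); rewrite !natrM /= => e.
rewrite exprS.
transitivity (- ((-1) ^+ j) * (j.+1%:R * 'C(n.+1, j.+1)%:R) *
  \prod_(u <- us) (u + j.+1%:R)); first by ring.
by rewrite -e; ring.
Qed.

Lemma prod_nat_shift (G : nat -> R) k j : \prod_(0 <= i < k + j) G i =
  \prod_(0 <= i < j) G i * \prod_(0 <= i < k) G (i + j)%N.
Proof.
rewrite (big_cat_nat (leq0n j) (leq_addl k j)) /=; congr (_ * _).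
by rewrite -[X in \prod_(X <= _ < _) _]add0n big_addn addnK.
Qed.

(** Coefficient of x^j in the monic multiple of 2F2(-n, e; a+1, b+1; x). *)
Definition hyp_coef n e a b j : R :=
  (-1) ^+ (n + j) * 'C(n, j)%:R *
  \prod_(j <= i < n) ((a + 1 + i%:R) * (b + 1 + i%:R) / (e + i%:R)).

Definition hyp_poly n e a b : {poly R} := \poly_(j < n.+1) hyp_coef n e a b j.

Lemma coef_hyp_poly n e a b j : (hyp_poly n e a b)`_j = hyp_coef n e a b j.
Proof.
rewrite coef_poly; case: ltnP => // lt_nj.
by rewrite /hyp_coef bin_small// mulr0 mul0r.
Qed.

Lemma hyp_coef_lead n e a b : hyp_coef n e a b n = 1.
Proof. by rewrite /hyp_coef big_geq// binn addnn -mul2n exprM sqrrN !expr1n !mulr1. Qed.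

Lemma size_hyp_poly n e a b : size (hyp_poly n e a b) = n.+1.
Proof. by apply: size_poly_eq; rewrite hyp_coef_lead oner_neq0. Qed.

Lemma monic_hyp_poly n e a b : hyp_poly n e a b \is monic.
Proof. by rewrite monicE lead_coefE size_hyp_poly coef_hyp_poly hyp_coef_lead. Qed.

(** The product of the coefficient of x^j and the moment of order k + j is, up
    to a factor independent of j, the number (-1)^j C(n, j) times a product of
    k + k + (N - k) linear factors in j. *)
Lemma moment_functional_hyp_poly m a b f n N k :
  -1 < a -> -1 < b -> 0 < f ->
  (forall i, (f + i%:R) * m i.+1 = (a + 1 + i%:R) * (b + 1 + i%:R) * m i) ->
  (k <= N)%N -> (k + N < n)%N ->
  moment_functional m k (hyp_poly n (f + N%:R) a b) = 0.
Proof.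
move=> a1 b1 f0 mrec le_kN lt_n.
have pos (x : R) i : 0 < x -> x + i%:R != 0 by move=> x0; rewrite gt_eqF// ltr_wpDr.
have na i : a + 1 + i%:R != 0 by apply: pos; lra.
have nb i : b + 1 + i%:R != 0 by apply: pos; lra.
have nf i : f + i%:R != 0 by exact: pos.
pose W i := \prod_(0 <= j < i) ((a + 1 + j%:R) * (b + 1 + j%:R)).
pose F i := \prod_(0 <= j < i) (f + j%:R).
have W0 i : W i != 0 by rewrite prodf_seq_neq0; apply/allP => j _; rewrite mulf_neq0.
have F0 i : F i != 0 by rewrite prodf_seq_neq0; apply/allP => j _ /=.
have mE i : m i = m 0%N * W i / F i.
  elim: i => [|i IH]; first by rewrite /W /F !big_geq// divr1 mulr1.
  apply: (mulfI (nf i)); rewrite mrec IH /W /F !big_nat_recr//= -/(W i) -/(F i).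
  by field; rewrite F0 nf.
(* W (k + j) / W j consists of the factors a + 1 + i + j and b + 1 + i + j with
   i < k, and F (N + j) / F (k + j) of the factors f + i + j with k <= i < N. *)
pose us := [seq a + 1 + i%:R | i <- iota 0 k] ++ [seq b + 1 + i%:R | i <- iota 0 k]
   ++ [seq f + i%:R | i <- iota k (N - k)].
have sus : (size us < n)%N.
  rewrite !size_cat !size_map !size_iota; apply: leq_ltn_trans lt_n.
  by rewrite leq_add2l subnKC.
have usE j : \prod_(u <- us) (u + j%:R) =
   W (k + j)%N / W j * (F (N + j)%N / F (k + j)%N).
  rewrite /us !big_cat !big_map /= mulrA; congr (_ * _).
    rewrite /W prod_nat_shift -/(W j) [RHS]mulrAC mulfV// mul1r -big_split/=.
    rewrite /index_iota subn0; apply: eq_bigr => i _.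
    by rewrite natrD !addrA.
  rewrite /F !(prod_nat_shift _ _ j) -/(F j) (big_cat_nat (leq0n k) le_kN) /=.
  have h : \prod_(0 <= i < k) (f + (i + j)%:R) != 0.
    by rewrite prodf_seq_neq0; apply/allP => i _ /=.
  rewrite invfM mulrACA mulfV// mul1r mulrAC mulfV// mul1r.
  by apply: eq_bigr => i _; rewrite natrD addrA.
have coefE (j : 'I_n.+1) : hyp_coef n (f + N%:R) a b j =
    (-1) ^+ n * W n / F (n + N)%N * ((-1) ^+ j * 'C(n, j)%:R * (F (N + j)%N / W j)).
  have le_jn : (j <= n)%N by rewrite -ltnS.
  rewrite /hyp_coef exprD big_split /= prodfV.
  have -> : \prod_(j <= i < n) ((a + 1 + i%:R) * (b + 1 + i%:R)) = W n / W j.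
    by rewrite /W (big_cat_nat (leq0n j) le_jn) /= -/(W j) [RHS]mulrAC mulfV// mul1r.
  have -> : \prod_(j <= i < n) (f + N%:R + i%:R) = F (n + N)%N / F (N + j)%N.
    have h : \prod_(0 <= i < j) (f + (i + N)%:R) != 0.
      by rewrite prodf_seq_neq0; apply/allP => i _ /=.
    rewrite (addnC N) /F !prod_nat_shift -/(F N) (big_cat_nat (leq0n j) le_jn) /=.
    rewrite invfM mulrACA mulfV// mul1r mulrAC mulfV// mul1r.
    by apply: eq_bigr => i _; rewrite addnC natrD addrA.
  by field; rewrite !W0 !F0.
rewrite /moment_functional size_hyp_poly.
transitivity (m 0%N * ((-1) ^+ n * W n / F (n + N)%N) *
   \sum_(j < n.+1) (-1) ^+ j * 'C(n, j)%:R * \prod_(u <- us) (u + j%:R)); last first.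
  by rewrite alternating_sum_prod// mulr0.
rewrite mulr_sumr; apply: eq_bigr => j _.
rewrite coef_hyp_poly coefE mE usE; field.
by rewrite !W0 !F0.
Qed.

Lemma hyp_polyC n e a b : hyp_poly n e a b = hyp_poly n e b a.
Proof.
apply/polyP => j; rewrite !coef_hyp_poly /hyp_coef; congr (_ * _).
by apply: eq_bigr => i _; rewrite mulrAC mulrC mulrA.
Qed.

Lemma prod_nat_shift1 (x : R) j n : (j <= n)%N ->
  (x + j%:R) * \prod_(j <= i < n) (x + 1 + i%:R) =
  \prod_(j <= i < n) (x + i%:R) * (x + n%:R).
Proof.
move=> le_jn; have e i : x + 1 + i%:R = x + i.+1%:R by rewrite -natr1 -addrA (addrC 1).
under eq_bigr do rewrite e.
by rewrite -(big_add1 _ _ j n.+1 xpredT (fun i => x + i%:R)) -big_ltn// big_nat_recr.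
Qed.

Lemma hyp_coefE n e a b j : hyp_coef n e a b j = (-1) ^+ (n + j) * 'C(n, j)%:R *
  (\prod_(j <= i < n) (a + 1 + i%:R) * \prod_(j <= i < n) (b + 1 + i%:R) /
   \prod_(j <= i < n) (e + i%:R)).
Proof. by rewrite /hyp_coef big_split /= prodfV big_split. Qed.

Lemma binS_rat n j : (j <= n)%N ->
  'C(n.+1, j)%:R = n.+1%:R / (n.+1%:R - j%:R) * 'C(n, j)%:R :> R.
Proof.
move=> le_jn; have h : n.+1%:R - j%:R != 0 :> R.
  by rewrite -natrB ?(leqW le_jn)// pnatr_eq0 subn_eq0 -ltnNge.
apply: (mulfI h); rewrite mulrA mulrCA mulfV// mulr1 -natrB ?(leqW le_jn)//.
by rewrite -!natrM mul_bin_down.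
Qed.

Section Contiguity.
Variables (n : nat) (e a b : R).
Hypotheses (a1 : -1 < a) (e0 : 0 < e).

Let pos (x : R) i : 0 < x -> x + i%:R != 0.
Proof. by move=> x0; rewrite gt_eqF// ltr_wpDr. Qed.
Let na i : a + 1 + i%:R != 0.
Proof. by apply: pos; rewrite -ltrBlDr sub0r. Qed.
Let ne i : e + i%:R != 0. Proof. exact: pos. Qed.
Let nj j : (j <= n)%N -> n.+1%:R - j%:R != 0 :> R.
Proof. by move=> le_jn; rewrite -natrB ?(leqW le_jn)// pnatr_eq0 subn_eq0 -ltnNge. Qed.

Let shift (x : R) j l : x + j%:R != 0 -> (j <= l)%N ->
  \prod_(j <= i < l) (x + 1 + i%:R) =
  \prod_(j <= i < l) (x + i%:R) * (x + l%:R) / (x + j%:R).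
Proof.
by move=> xj le_jl; apply: (mulfI xj); rewrite prod_nat_shift1// mulrCA mulfV// mulr1.
Qed.

Let E0 j : \prod_(j <= i < n) (e + i%:R) != 0.
Proof. by rewrite prodf_seq_neq0; apply/allP => i _ /=. Qed.

(** Raising a by one multiplies the coefficient of x^j by
    (a + n + 2) / (a + 1 + j), so that the difference carries the factor
    n + 1 - j that turns C(n+1, j) into a multiple of C(n, j).  The next lemma is
    the case in which e grows along with a. *)
Lemma hyp_poly_shift_a : hyp_poly n.+1 e a b = hyp_poly n.+1 e (a + 1) b +
  (n.+1%:R * (b + n.+1%:R) / (e + n%:R)) *: hyp_poly n e (a + 1) b.
Proof.
apply/polyP => j; rewrite coefD coefZ !coef_hyp_poly.
have [le_jn|] := leqP j n; last rewrite leq_eqVlt => /orP[/eqP <-|lt_nj].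
- rewrite !hyp_coefE addSn exprS (binS_rat le_jn).
  rewrite !(shift (x := a + 1)) ?leqW//.
  rewrite !big_nat_recr//=.
  set A := \prod_(j <= i < n) (a + 1 + i%:R); set B := \prod_(j <= i < n) (b + 1 + i%:R).
  have := E0 j; set E := \prod_(j <= i < n) (e + i%:R) => EN0.
  have h1 := na j; have h2 := nj le_jn; have h3 := ne n.
  by rewrite -!natr1 in h2 *; field; rewrite EN0 h1 h2 h3.
- rewrite !hyp_coef_lead /hyp_coef bin_small// mulr0 mul0r mulr0 addr0//.
- by rewrite /hyp_coef !bin_small// ?(ltnW lt_nj)// !(mulr0, mul0r) addr0.
Qed.

Lemma hyp_poly_shift_ae : hyp_poly n.+1 e a b = hyp_poly n.+1 (e + 1) (a + 1) b +
  (n.+1%:R * (b + n.+1%:R) * (e - a - 1) / ((e + n.+1%:R) * (e + n%:R))) *: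
  hyp_poly n e (a + 1) b.
Proof.
apply/polyP => j; rewrite coefD coefZ !coef_hyp_poly.
have [le_jn|] := leqP j n; last rewrite leq_eqVlt => /orP[/eqP <-|lt_nj].
- rewrite !hyp_coefE addSn exprS (binS_rat le_jn).
  rewrite !(shift (x := a + 1)) ?leqW// !(shift (x := e)) ?leqW//.
  rewrite !big_nat_recr//=.
  set A := \prod_(j <= i < n) (a + 1 + i%:R); set B := \prod_(j <= i < n) (b + 1 + i%:R).
  have := E0 j; set E := \prod_(j <= i < n) (e + i%:R) => EN0.
  have h1 := na j; have h2 := nj le_jn; have h3 := ne n; have h4 := ne j; have h5 := ne n.+1.
  by rewrite -!natr1 in h2 h5 *; field; rewrite EN0 h1 h2 h3 h4 h5.
- rewrite !hyp_coef_lead /hyp_coef bin_small// mulr0 mul0r mulr0 addr0//.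
- by rewrite /hyp_coef !bin_small// ?(ltnW lt_nj)// !(mulr0, mul0r) addr0.
Qed.

Let coefX j : (j <= n)%N -> ('X * hyp_poly n (e + 1) (a + 1) (b + 1))`_j =
  - (-1) ^+ (n + j) * (j%:R / (n.+1%:R - j%:R) * 'C(n, j)%:R) *
  (\prod_(j <= i < n) (a + 1 + i%:R) * (a + 1 + n%:R) *
   (\prod_(j <= i < n) (b + 1 + i%:R) * (b + 1 + n%:R)) /
   (\prod_(j <= i < n) (e + i%:R) * (e + n%:R))).
Proof.
case: j => [|j] le_jn; first by rewrite coefXM /= !(mul0r, mulr0).
rewrite coefXM /= coef_hyp_poly hyp_coefE.
have S (x : R) : \prod_(j <= i < n) (x + 1 + i%:R) = \prod_(j.+1 <= i < n) (x + i%:R) * (x + n%:R).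
  rewrite -big_nat_recr// [RHS]big_add1 /=; apply: eq_bigr => i _.
  by rewrite -natr1 -addrA (addrC 1).
rewrite !S addnS exprS mulN1r opprK; congr (_ * _ * _).
have h := nj le_jn; apply: (mulfI h); rewrite mulrA mulrCA mulfV// mulr1.
rewrite -natrB ?(leqW le_jn)// subSS -!natrM; congr (_%:R).
by rewrite mul_bin_left.
Qed.

(** In 'X * p the coefficients move up by one place, which the shift of all
    three parameters compensates.  In the next lemma e grows with the
    degree. *)
Lemma hyp_poly_mulX : 'X * hyp_poly n (e + 1) (a + 1) (b + 1) = hyp_poly n.+1 e a b +
  ((a + n.+1%:R) * (b + n.+1%:R) / (e + n%:R)) *: hyp_poly n e a b.
Proof.
apply/polyP => j; rewrite coefD coefZ !coef_hyp_poly.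
have [le_jn|] := leqP j n; last rewrite leq_eqVlt => /orP[/eqP <-|lt_nj].
- rewrite coefX// !hyp_coefE addSn exprS (binS_rat le_jn) !big_nat_recr//=.
  set A := \prod_(j <= i < n) (a + 1 + i%:R); set B := \prod_(j <= i < n) (b + 1 + i%:R).
  have := E0 j; set E := \prod_(j <= i < n) (e + i%:R) => EN0.
  have h2 := nj le_jn; have h3 := ne n.
  by rewrite -!natr1 in h2 *; field; rewrite EN0 h2 h3.
- rewrite coefXM /= coef_hyp_poly !hyp_coef_lead /hyp_coef bin_small//.
  by rewrite mulr0 mul0r mulr0 addr0.
- rewrite coefXM; case: j lt_nj => // j lt_nj /=; rewrite coef_hyp_poly.
  by rewrite /hyp_coef !bin_small// ?(ltnW lt_nj)// !(mulr0, mul0r) addr0.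
Qed.

Lemma hyp_poly_mulX_e : 'X * hyp_poly n (e + 1) (a + 1) (b + 1) =
  hyp_poly n.+1 (e + 1) a b +
  ((a + n.+1%:R) * (b + n.+1%:R) * e / ((e + n.+1%:R) * (e + n%:R))) *: hyp_poly n e a b.
Proof.
apply/polyP => j; rewrite coefD coefZ !coef_hyp_poly.
have [le_jn|] := leqP j n; last rewrite leq_eqVlt => /orP[/eqP <-|lt_nj].
- rewrite coefX// !hyp_coefE addSn exprS (binS_rat le_jn).
  rewrite !(shift (x := e)) ?leqW// !big_nat_recr//=.
  set A := \prod_(j <= i < n) (a + 1 + i%:R); set B := \prod_(j <= i < n) (b + 1 + i%:R).
  have := E0 j; set E := \prod_(j <= i < n) (e + i%:R) => EN0.
  have h2 := nj le_jn; have h3 := ne n; have h4 := ne j; have h5 := ne n.+1.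
  by rewrite -!natr1 in h2 h5 *; field; rewrite EN0 h2 h3 h4 h5.
- rewrite coefXM /= coef_hyp_poly !hyp_coef_lead /hyp_coef bin_small//.
  by rewrite mulr0 mul0r mulr0 addr0.
- rewrite coefXM; case: j lt_nj => // j lt_nj /=; rewrite coef_hyp_poly.
  by rewrite /hyp_coef !bin_small// ?(ltnW lt_nj)// !(mulr0, mul0r) addr0.
Qed.

End Contiguity.

End HypergeometricPolynomials.

(** * Interlacing of zeros *)

Section Interlacing.
Variable R : rcfType.
Implicit Types (z w : nat -> R) (p q r : {poly R}).

Definition root_prod w n : {poly R} := \prod_(0 <= j < n) ('X - (w j)%:P).

(** z lists in decreasing order all the zeros of r, q and p, in the cyclic order
    r, q, p, r, q, p, ...  The value z N = 0 encodes the positivity of the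
    zeros and serves as the last sign-change point when the degree grows. *)
Definition interlaced N z r q p :=
  [/\ forall i, (i < N)%N -> z i.+1 < z i, z N = 0,
      r = root_prod (fun j => z (3 * j)%N) (N.+2 %/ 3),
      q = root_prod (fun j => z (3 * j).+1) (N.+1 %/ 3) &
      p = root_prod (fun j => z (3 * j).+2) (N %/ 3)].

Lemma decreasing_lt z N : (forall i, (i < N)%N -> z i.+1 < z i) ->
  forall i j, (i < j)%N -> (j <= N)%N -> z j < z i.
Proof.
move=> dz i j; elim: j => // j IH; rewrite ltnS leq_eqVlt => /orP[/eqP ->|lt_ij] le_jN.
  exact: dz.
by apply: lt_trans (dz _ le_jN) (IH lt_ij (ltnW le_jN)).
Qed.

Lemma root_prod_monic w n : root_prod w n \is monic.
Proof. exact: monic_prod_XsubC. Qed.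

Lemma size_root_prod w n : size (root_prod w n) = n.+1.
Proof. by rewrite /root_prod size_prod_XsubC /index_iota size_iota subn0. Qed.

Lemma horner_root_prod w n x : (root_prod w n).[x] = \prod_(0 <= j < n) (x - w j).
Proof.
by rewrite /root_prod horner_prod; apply: eq_bigr => j _; rewrite hornerXsubC.
Qed.

Lemma root_root_prod w n k : (k < n)%N -> (root_prod w n).[w k] = 0.
Proof.
move=> lt_kn; rewrite horner_root_prod big_mkord (bigD1 (Ordinal lt_kn))//=.
by rewrite subrr mul0r.
Qed.

(** Each of the k zeros above x contributes a sign. *)
Lemma sign_root_prod w n k x : (k <= n)%N -> (forall j, (j < k)%N -> x < w j) ->
  (forall j, (k <= j < n)%N -> w j < x) -> 0 < (-1) ^+ k * (root_prod w n).[x].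
Proof.
rewrite horner_root_prod => le_kn lo hi.
rewrite (big_cat_nat (leq0n k) le_kn) /= mulrA mulr_gt0//.
  rewrite -{1}[k]subn0 -prodr_const_nat -big_split /= big_nat_cond.
  apply: prodr_gt0 => j /andP[/andP[_ lt_jk] _].
  by rewrite mulN1r opprB subr_gt0 lo.
rewrite big_nat_cond; apply: prodr_gt0 => j /andP[lt_j _].
by rewrite subr_gt0 hi.
Qed.

Lemma poly_sign_change_root (p : {poly R}) (x y : R) : x < y -> p.[x] * p.[y] < 0 ->
  exists t, [/\ x < t, t < y & root p t].
Proof.
move=> lt_xy pxy; have [t] := polyrcf.poly_ivt (ltW lt_xy) (ltW pxy).
rewrite in_itv/= => /andP[le_xt le_ty] rt; exists t.
split => //; rewrite lt_neqAle ?le_xt ?le_ty andbT; apply: contraTneq pxy => e.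
  by rewrite e (rootP rt) mul0r ltxx.
by rewrite -e (rootP rt) mulr0 ltxx.
Qed.

Lemma monic_root_above (p : {poly R}) (x : R) : p \is monic -> p.[x] < 0 ->
  exists2 t, x < t & root p t.
Proof.
rewrite monicE => /eqP lp px.
have [|n hn] := polyrcf.poly_pinfty_gt_lc (p := p); first by rewrite lp.
have [||t [xt _ rt]] := @poly_sign_change_root p x (Num.max n (x + 1)).
- by rewrite lt_max ltrDl ltr01 orbT.
- rewrite nmulr_rlt0//; apply: lt_le_trans (hn _ _); first by rewrite lp.
  by rewrite le_max lexx.
by exists t.
Qed.

Lemma root_prod_eq p w n : p \is monic -> size p = n.+1 ->
  (forall i j, (i < j < n)%N -> w j < w i) ->
  (forall i, (i < n)%N -> root p (w i)) -> p = root_prod w n.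
Proof.
move=> mp sp dw rw.
have := @all_roots_prod_XsubC R p [seq w i | i <- iota 0 n].
rewrite size_map size_iota => /(_ sp).
have -> : all (root p) [seq w i | i <- iota 0 n].
  by apply/allP => x /mapP[i]; rewrite mem_iota add0n => /andP[_ lt_in] ->; exact: rw.
move=> /(_ isT); rewrite uniq_rootsE map_inj_in_uniq ?iota_uniq; last first.
  move=> i j; rewrite !mem_iota !add0n /= => lt_in lt_jn e.
  have [lt_ij|lt_ji|//] := ltngtP i j.
    by have := dw i j; rewrite lt_ij lt_jn e ltxx => /(_ isT).
  by have := dw j i; rewrite lt_ji lt_in e ltxx => /(_ isT).
move=> /(_ isT) ->; rewrite (eqP (mp : lead_coef p == 1)) scale1r big_map.
by rewrite /root_prod /index_iota subn0.
Qed.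

(** At each zero of r the new polynomial has the sign opposite to p, and at each
    zero of q the polynomials r and - p have equal signs.  This gives one sign
    change between z (3 k + 3) and z (3 k + 1) for each k, and one more zero above
    z 0.  These are all the zeros, by degree, and they lie so that the list of
    zeros of the new polynomial, r and q is again cyclic.  When 3 divides N, r
    and p have equal degree and the factor 'X adds the zero 0 = z N to those
    of r. *)
Lemma interlaced_step N z r q p (l : R) : 0 < l -> interlaced N z r q p ->
  exists z', interlaced N.+1 z' ((if (3 %| N)%N then 'X * r else r) - l *: p) r q.
Proof.
move=> l0 [dz zN rE qE pE]; set s := _ - _; set K := (N %/ 3)%N.
have ltz := decreasing_lt dz.
have divK : (K * 3 <= N < K.+1 * 3)%N by rewrite leq_trunc_div ltn_ceil.
pose xr := if (3 %| N)%N then 'X * r else r.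
have mxr : xr \is monic /\ size xr = K.+2.
  rewrite /xr; case: ifP => d3.
    rewrite monicMl ?monicX// rE root_prod_monic; split => //.
    rewrite mulrC size_mulX ?monic_neq0 ?root_prod_monic// size_root_prod; congr _.+2.
    by rewrite /K; lia.
  by rewrite rE root_prod_monic size_root_prod; split => //; congr _.+1; rewrite /K; lia.
have szp : (size (l *: p) < size xr)%N.
  by rewrite mxr.2 (leq_ltn_trans (size_scale_leq _ _))// pE size_root_prod.
have ss : size s = K.+2 by rewrite /s size_polyDl ?mxr.2// size_polyN -mxr.2.
have ms : s \is monic.
  by rewrite monicE /s lead_coefDl ?size_polyN// -monicE mxr.1.
have sx x : s.[x] = xr.[x] - l * p.[x] by rewrite /s hornerD hornerN hornerZ.
have p3 k : (k <= K)%N -> 0 < (-1) ^+ k * p.[z (3 * k)%N].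
  move=> le_kK; rewrite pE; apply: sign_root_prod => // j hj; apply: ltz; lia.
have xr3 k : (k <= K)%N -> xr.[z (3 * k)%N] = 0.
  move=> le_kK; rewrite /xr; have [e|ne] := eqVneq (3 * k)%N N.
    by rewrite -{1}e dvdn_mulr// e zN hornerM hornerX mul0r.
  have r0 : r.[z (3 * k)%N] = 0 by rewrite rE (@root_root_prod (fun j => z (3 * j)%N))//; lia.
  by case: ifP => _; rewrite ?hornerM r0 ?mulr0.
have s3 k : (k <= K)%N -> (-1) ^+ k * s.[z (3 * k)%N] < 0.
  move=> le_kK; rewrite sx xr3// sub0r mulrN oppr_lt0 mulrCA mulr_gt0//.
  exact: p3.
have s1 k : (k < K)%N -> (-1) ^+ k * s.[z (3 * k).+1] < 0.
  move=> lt_kK; rewrite sx mulrBr subr_lt0.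
  have hp : 0 < (-1) ^+ k * p.[z (3 * k).+1].
    rewrite pE; apply: sign_root_prod; first lia; move=> j hj; apply: ltz; lia.
  have hr : 0 < (-1) ^+ k.+1 * r.[z (3 * k).+1].
    rewrite rE; apply: sign_root_prod; first lia; move=> j hj; apply: ltz; lia.
  have hz : 0 < z (3 * k).+1 by rewrite -zN; apply: ltz; lia.
  have hxr : 0 < (-1) ^+ k.+1 * xr.[z (3 * k).+1].
    by rewrite /xr; case: ifP => _ //; rewrite hornerM hornerX mulrCA mulr_gt0.
  apply: (@lt_trans _ _ 0).
    by rewrite -oppr_gt0 -mulNr -mulN1r -exprS.
  by rewrite mulrCA mulr_gt0.
have [t0 ht0 rt0] : exists2 t, z 0%N < t & root s t.
  apply: monic_root_above => //.
  by have := s3 0%N (leq0n K); rewrite muln0 expr0 mul1r.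
have mid k : exists t, (k < K)%N -> [/\ z (3 * k.+1)%N < t, t < z (3 * k).+1 & root s t].
  have [lt_kK|] := boolP (k < K)%N; last by exists 0.
  have [||t ht] := @poly_sign_change_root s (z (3 * k.+1)%N) (z (3 * k).+1).
  - by apply: ltz; lia.
  - have h1 := s1 k lt_kK; have h3 := s3 k.+1 lt_kK.
    rewrite exprS mulN1r mulNr oppr_lt0 in h3.
    have := nmulr_rlt0 ((-1) ^+ k * s.[z (3 * k.+1)%N]) h1; rewrite h3.
    by rewrite mulrACA -expr2 sqrr_sign mul1r mulrC => ->.
  by exists t.
have [f hf] := choice mid.
(* The zeros of the new polynomial; the value 0 beyond them makes z' vanish at
   N.+1. *)
pose sg k := if k is k'.+1 then (if (k' < K)%N then f k' else 0) else t0.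
have sgr k : (k <= K)%N -> root s (sg k).
  by case: k => [//|k] lt_kK; rewrite /sg lt_kK; have [] := hf k lt_kK.
have sglo k : (k <= K)%N -> z (3 * k)%N < sg k.
  by case: k => [//|k] lt_kK; rewrite /sg lt_kK; have [] := hf k lt_kK.
have sghi k : (k < K)%N -> sg k.+1 < z (3 * k).+1.
  by move=> lt_kK; rewrite /sg lt_kK; have [] := hf k lt_kK.
pose z' i := match (i %% 3)%N with 0%N => sg (i %/ 3)%N | 1%N => z (3 * (i %/ 3))%N
  | _ => z (3 * (i %/ 3)).+1 end.
have z'0 k : z' (3 * k)%N = sg k by rewrite /z' mulnC modnMl mulnK.
have z'1 k : z' (3 * k).+1 = z (3 * k)%N.
  have e1 : ((3 * k).+1 %% 3 = 1)%N by lia.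
  have e2 : ((3 * k).+1 %/ 3 = k)%N by lia.
  by rewrite /z' e1 e2.
have z'2 k : z' (3 * k).+2 = z (3 * k).+1.
  have e1 : ((3 * k).+2 %% 3 = 2)%N by lia.
  have e2 : ((3 * k).+2 %/ 3 = k)%N by lia.
  by rewrite /z' e1 e2.
have cases i : exists k, [\/ i = (3 * k)%N, i = (3 * k).+1 | i = (3 * k).+2].
  exists (i %/ 3)%N; have := ltn_pmod i (isT : (0 < 3)%N); have := divn_eq i 3.
  case: (i %% 3)%N => [|[|[|//]]] e _; [apply: Or31|apply: Or32|apply: Or33]; lia.
have dz' i : (i < N.+1)%N -> z' i.+1 < z' i.
  move=> lt_iN; have [k [] e] := cases i; rewrite {i}e in lt_iN *.
  - by rewrite z'1 z'0; apply: sglo; lia.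
  - by rewrite z'1 z'2; apply: ltz; lia.
  - rewrite z'2 (_ : (3 * k).+3 = 3 * k.+1)%N ?z'0; last lia.
    have [lt_kK|le_Kk] := ltnP k K; first exact: sghi.
    rewrite /sg ltnNge le_Kk /= -zN; apply: ltz; lia.
have ltz' := decreasing_lt dz'.
exists z'; split => //.
- have [k [] e] := cases N.+1; rewrite e.
  + by rewrite z'0 /sg; case: k e => [//|k] e; rewrite ifF//; lia.
  + by rewrite z'1 -zN; congr (z _); lia.
  + by rewrite z'2 -zN; congr (z _); lia.
- rewrite (_ : N.+3 %/ 3 = K.+1)%N; last by rewrite /K; lia.
  apply: root_prod_eq => //.
    by move=> i j hij; apply: ltz'; lia.
  by move=> i hi; rewrite z'0; exact: sgr.
- by rewrite rE /root_prod; apply: eq_bigr => j _; rewrite z'1.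
- by rewrite qE /root_prod; apply: eq_bigr => j _; rewrite z'2.
Qed.

Lemma interlaced_zeros N z r q p : interlaced N z r q p ->
  exists s : seq R, [/\ size s = (N.+2 %/ 3)%N, uniq s &
    forall x, x \in s -> [/\ 0 < x, root r x & mup x r = 1%N]].
Proof.
move=> [dz zN rE _ _]; have ltz := decreasing_lt dz.
pose n := (N.+2 %/ 3)%N.
have us : uniq [seq z (3 * j)%N | j <- iota 0 n].
  rewrite map_inj_in_uniq ?iota_uniq// => i j; rewrite !mem_iota !add0n /= => lt_in lt_jn e.
  have [lt_ij|lt_ji|//] := ltngtP i j.
    by have := ltz (3 * i)%N (3 * j)%N; rewrite e ltxx; lia.
  by have := ltz (3 * j)%N (3 * i)%N; rewrite e ltxx; lia.
exists [seq z (3 * j)%N | j <- iota 0 n]; split => //.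
  by rewrite size_map size_iota.
move=> x xs; have rE' : r = \prod_(y <- [seq z (3 * j)%N | j <- iota 0 n]) ('X - y%:P).
  by rewrite big_map rE /root_prod /index_iota subn0.
have [j jn xE] := mapP xs; rewrite mem_iota add0n /= in jn.
have lt_jN : (3 * j < N)%N by lia.
split.
- by rewrite xE -zN; exact: ltz.
- by rewrite rE' root_prod_XsubC.
- rewrite rE' (big_rem x xs) /= mupMl; last first.
    by rewrite root_prod_XsubC mem_rem_uniqF.
  by have := @mup_XsubCX R 1 x x; rewrite expr1 eqxx.
Qed.

End Interlacing.

(** * Step-line recurrence and growth *)

Section Growth.
Variable R : realFieldType.

(** By induction u (n+1) >= T u n: then u (n-1) <= u n / T and
    u (n-2) <= u n / T^2, and the recurrence yields u (n+1) >= T u n again. *)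
Lemma recurrence_growth (u be al ga : nat -> R) (x T : R) N : 0 < T -> u 0%N = 1 ->
  (forall n, u n.+1 = (x - be n) * u n - al n * u n.-1 - ga n * u n.-2) ->
  al 0%N = 0 -> ga 0%N = 0 -> ga 1%N = 0 ->
  (forall n, 0 <= al n) -> (forall n, 0 <= ga n) ->
  (forall n, (n < N)%N -> T + be n + al n / T + ga n / T ^+ 2 <= x) ->
  0 < u N.
Proof.
move=> T0 u0 urec al0 ga0 ga1 alp gap hx.
have T2 : 0 < T ^+ 2 by rewrite exprn_gt0.
suff h n : (n <= N)%N -> 0 < u n /\ (forall m, (m < n)%N -> T * u m <= u m.+1).
  by have [] := h N (leqnn N).
elim: n => [|n IH] lt_nN; first by rewrite u0 ltr01.
have [un up] := IH (ltnW lt_nN).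
have h1 : al n * u n.-1 <= al n * (u n / T).
  case: n {IH lt_nN} un up => [|n] un up; first by rewrite al0 !mul0r.
  by rewrite ler_wpM2l// ler_pdivlMr// mulrC up.
have h2 : ga n * u n.-2 <= ga n * (u n / T ^+ 2).
  case: n {IH lt_nN h1} un up => [|[|n]] un up; rewrite ?ga0 ?ga1 ?mul0r//.
  rewrite ler_wpM2l// ler_pdivlMr// mulrC expr2 -mulrA /=.
  by apply: (@le_trans _ _ (T * u n.+1)); [rewrite ler_pM2l// up|exact: up].
have key : T * u n <= u n.+1.
  rewrite urec; have := hx n lt_nN => hxn.
  have : (T + be n + al n / T + ga n / T ^+ 2) * u n <= x * u n by rewrite ler_pM2r.
  have -> : (T + be n + al n / T + ga n / T ^+ 2) * u n =
    T * u n + be n * u n + al n * (u n / T) + ga n * (u n / T ^+ 2) by ring.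
  by lra.
split; first by apply: lt_le_trans key; rewrite mulr_gt0.
move=> m; rewrite ltnS leq_eqVlt => /orP[/eqP -> //|]; exact: up.
Qed.

Lemma addS_ge0 (p : R) n : -1 < p -> 0 <= p + n.+1%:R.
Proof.
have : 1 <= n.+1%:R :> R by rewrite ler1n.
by lra.
Qed.

(** If E = N/2 + O(1) then N^2 / (E + N) = (2/3) N + O(1) and
    E / (E + N) = 1/3 + O(1/N).  The lower bound g on E keeps the denominators
    away from 0 for small n, so that one constant serves for all n. *)
Lemma quotient_linear_bound (p q g G : R) : 0 < g -> 0 <= G -> -1 < p -> -1 < q ->
  exists2 k, 0 <= k & forall n (E : R), g <= E -> `|E - n.+1%:R / 2| <= G ->
    (p + n.+1%:R) * (q + n.+1%:R) / (E + n%:R) <= 2 / 3 * (n.+1%:R + k) /\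
    (p + n.+1%:R) * (q + n.+1%:R) / (E + n%:R) * (E / (E + n.+1%:R)) <=
      2 / 9 * (n.+1%:R + k).
Proof.
move=> g0 G0 p1 q1.
pose g' := Num.min g 1.
have g'0 : 0 < g' by rewrite lt_min g0 ltr01.
have g'g : g' <= g by rewrite ge_min lexx.
have g'1 : g' <= 1 by rewrite ge_min lexx orbT.
(* With D = E + n, the bounds D >= 3N/2 - G - 1 and D >= g' N give
   (2/3) (N + k1) D >= N^2 + (|p| + |q| + |pq|) N. *)
pose k1 := (`|p| + `|q| + `|p * q| + G + 1) * 3 / (2 * g').
have k10 : 0 <= k1.
  by apply: divr_ge0; rewrite mulr_ge0 ?(ltW g'0)// !addr_ge0.
pose k2 := (1 + k1) * G.
have k20 : 0 <= k2 by rewrite mulr_ge0// addr_ge0.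
have b1 n (E : R) : g <= E -> `|E - n.+1%:R / 2| <= G ->
    (p + n.+1%:R) * (q + n.+1%:R) / (E + n%:R) <= 2 / 3 * (n.+1%:R + k1).
  move=> gE; rewrite ler_norml => /andP[EG _].
  have n0 : 0 <= n%:R :> R by [].
  have N1 : 1 <= n.+1%:R :> R by rewrite ler1n.
  have eN : n%:R = n.+1%:R - 1 :> R by rewrite -natr1 addrK.
  set N := n.+1%:R in EG N1 eN *.
  have D0 : 0 < E + n%:R by lra.
  rewrite ler_pdivrMr//.
  have D1 : g' * N <= E + n%:R.
    have : 0 <= (1 - g') * n%:R by rewrite mulr_ge0// subr_ge0.
    by rewrite eN; lra.
  have D2 : 3 / 2 * N - G - 1 <= E + n%:R by rewrite eN; lra.
  have D1' : k1 * (g' * N) <= k1 * (E + n%:R) by rewrite ler_wpM2l.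
  have D2' : N * (3 / 2 * N - G - 1) <= N * (E + n%:R) by rewrite ler_wpM2l//; lra.
  have k1E : k1 * (g' * N) = 3 / 2 * (`|p| + `|q| + `|p * q| + G + 1) * N.
    by rewrite /k1; field; rewrite gt_eqF.
  have hp : p * N <= `|p| * N by rewrite ler_wpM2r ?ler_norm//; lra.
  have hq : q * N <= `|q| * N by rewrite ler_wpM2r ?ler_norm//; lra.
  have hpq : p * q <= `|p * q| * N.
    apply: (@le_trans _ _ (`|p * q| * 1)); first by rewrite mulr1 ler_norm.
    by rewrite ler_wpM2l.
  have hG : 0 <= G * N by rewrite mulr_ge0//; lra.
  rewrite k1E in D1'; nra.
exists (k1 + 3 * k2); first by rewrite addr_ge0// mulr_ge0.
move=> n E gE EG; have h1 := b1 n E gE EG; split.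
  by apply: le_trans h1 _; rewrite ler_pM2l//; lra.
have E0 : 0 < E by exact: lt_le_trans gE.
have N0 : 0 < n.+1%:R :> R by [].
have N1 : 1 <= n.+1%:R :> R by rewrite ler1n.
have h2 : E / (E + n.+1%:R) <= 1 / 3 + k2 / (n.+1%:R + k1).
  move: EG; rewrite ler_norml => /andP[_ EG].
  set N := n.+1%:R in N0 N1 EG *.
  have Nk : 0 < N + k1 by lra.
  rewrite ler_pdivrMr ?addr_gt0//.
  have hk : G <= k2 / (N + k1) * (E + N).
    rewrite /k2 mulrAC ler_pdivlMr// mulrAC [leLHS]mulrC ler_wpM2r//.
    have : 0 <= k1 * (E + N - 1) by rewrite mulr_ge0//; lra.
    by lra.
  by rewrite mulrDl; lra.
apply: (@le_trans _ _ (2 / 3 * (n.+1%:R + k1) * (1 / 3 + k2 / (n.+1%:R + k1)))).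
  apply: ler_pM => //.
    rewrite divr_ge0// ?mulr_ge0//; [lra|lra|by rewrite addr_ge0// ltW].
  by rewrite divr_ge0// ?addr_ge0// ltW.
have Nk : n.+1%:R + k1 != 0 by rewrite gt_eqF//; lra.
have expand (N K1 K2 : R) : N + K1 != 0 ->
    2 / 3 * (N + K1) * (1 / 3 + K2 / (N + K1)) = 2 / 9 * (N + (K1 + 3 * K2)).
  by move=> NK; field.
by rewrite expand.
Qed.

End Growth.

Section StepLine.
Variable R : rcfType.
Variables (a b g : R) (d : nat).
Hypotheses (a1 : -1 < a) (b1 : -1 < b) (ag : a + 1 < g) (bg : b + 1 < g).

Let g0 : 0 < g. Proof. by apply: lt_trans ag; rewrite -ltrBlDr sub0r. Qed.

(** The parameter e of the polynomial of degree n on the step-line; it grows by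
    one at every second degree, namely after the n with [jump n]. *)
Definition eparam n : R := g + ((n + d)./2)%:R.
Definition jump n : bool := odd (n + d).

Lemma eparamS n : eparam n.+1 = eparam n + (jump n)%:R.
Proof. by rewrite /eparam addSn -addrA -natrD -uphalfE uphalf_half addnC. Qed.

Lemma jumpS n : jump n.+1 = ~~ jump n. Proof. by []. Qed.

Lemma eparamSS n : eparam n.+2 = eparam n + 1.
Proof. by rewrite !eparamS jumpS; case: (jump n); rewrite /= ?addr0. Qed.

Lemma eparam_ge n : g <= eparam n. Proof. by rewrite lerDl. Qed.

Lemma eparam_gt0 n : 0 < eparam n. Proof. exact: lt_le_trans (eparam_ge n). Qed.

(** The three families of the chain; for g = c + b + 1, stepA n is P_n.  The
    parameter e advances so that the polynomials of degrees n and n - 1 in each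
    relation below are contiguous. *)
Definition stepA n := hyp_poly n (eparam n) a b.
Definition stepB n := hyp_poly n (eparam n.+1) (a + 1) b.
Definition stepC n := hyp_poly n (eparam n.+2) (a + 1) (b + 1).

(** Common shape of the coefficients of the three steps; the last factor is
    present when the parameter e jumps during the step. *)
Definition step_coef (j : bool) (h p q E : R) n : R :=
  (p + n.+1%:R) * (q + n.+1%:R) / (E + n%:R) * (if j then (E - h) / (E + n.+1%:R) else 1).

Definition coefAB n := step_coef (jump n.+1) (a + 1) 0 b (eparam n.+1) n.
Definition coefBC n := step_coef (jump n) (b + 1) 0 (a + 1) (eparam n.+2) n.
Definition coefCA n := step_coef (jump n) 0 a b (eparam n) n.

Lemma step_coef_gt0 j h p q E n : -1 < p -> -1 < q -> 0 < E -> h < E -> 0 < step_coef j h p q E n.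
Proof.
move=> p1 q1 E0 hE; have N1 : 1 <= n.+1%:R :> R by rewrite ler1n.
have n0 : 0 <= n%:R :> R by [].
rewrite /step_coef mulr_gt0//.
  rewrite divr_gt0// ?mulr_gt0//; [lra|lra|by rewrite ltr_wpDr].
by case: j => //; rewrite divr_gt0 ?subr_gt0// addr_gt0.
Qed.

Lemma coefAB_gt0 n : 0 < coefAB n.
Proof.
apply: step_coef_gt0; [exact: ltrN10|exact: b1|exact: eparam_gt0|].
exact: lt_le_trans (eparam_ge _).
Qed.

Lemma coefBC_gt0 n : 0 < coefBC n.
Proof.
apply: step_coef_gt0; [exact: ltrN10| |exact: eparam_gt0|].
  by rewrite (lt_trans a1)// ltrDl.
exact: lt_le_trans (eparam_ge _).
Qed.

Lemma coefCA_gt0 n : 0 < coefCA n.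
Proof. by apply: step_coef_gt0 => //; exact: eparam_gt0. Qed.

Lemma stepA_B n : stepA n.+1 = stepB n.+1 + coefAB n *: stepB n.
Proof.
rewrite /stepA /stepB /coefAB /step_coef [eparam n.+2]eparamS.
have := eparam_gt0 n.+1; case: (jump n.+1) => e0 /=.
  rewrite (hyp_poly_shift_ae _ b a1 e0) add0r; congr (_ + _ *: _).
  have h1 : eparam n.+1 + n%:R != 0 by rewrite gt_eqF// ltr_wpDr.
  have h2 : eparam n.+1 + n.+1%:R != 0 by rewrite gt_eqF// ltr_wpDr.
  by rewrite -!natr1 in h2 *; field; rewrite h1 h2.
by rewrite addr0 (hyp_poly_shift_a _ b a1 e0) add0r mulr1.
Qed.

Lemma stepB_C n : stepB n.+1 = stepC n.+1 + coefBC n *: stepC n.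
Proof.
rewrite /stepB /stepC /coefBC /step_coef [eparam n.+3]eparamS !jumpS negbK.
rewrite !(hyp_polyC _ _ (a + 1)).
have := eparam_gt0 n.+2; case: (jump n) => e0 /=.
  rewrite (hyp_poly_shift_ae _ (a + 1) b1 e0) add0r; congr (_ + _ *: _).
  have h1 : eparam n.+2 + n%:R != 0 by rewrite gt_eqF// ltr_wpDr.
  have h2 : eparam n.+2 + n.+1%:R != 0 by rewrite gt_eqF// ltr_wpDr.
  by rewrite -!natr1 in h2 *; field; rewrite h1 h2.
by rewrite addr0 (hyp_poly_shift_a _ (a + 1) b1 e0) add0r mulr1.
Qed.

Lemma stepC_A n : 'X * stepC n = stepA n.+1 + coefCA n *: stepA n.
Proof.
rewrite /stepA /stepC /coefCA /step_coef eparamSS eparamS.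
have e0 := eparam_gt0 n; case: (jump n) => /=.
  rewrite (hyp_poly_mulX_e _ _ _ e0) subr0; congr (_ + _ *: _).
  have h1 : eparam n + n%:R != 0 by rewrite gt_eqF// ltr_wpDr.
  have h2 : eparam n + n.+1%:R != 0 by rewrite gt_eqF// ltr_wpDr.
  by rewrite -!natr1 in h2 *; field; rewrite h1 h2.
by rewrite addr0 (hyp_poly_mulX _ _ _ e0) mulr1.
Qed.

Lemma hyp_poly0 (e p q : R) : hyp_poly 0 e p q = 1.
Proof.
apply/polyP => -[|j]; rewrite coef_hyp_poly ?hyp_coef_lead coef1//.
by rewrite /hyp_coef bin_small// mulr0 mul0r.
Qed.

Lemma interlaced_steps n : exists z, interlaced (3 * n) z (stepC n) (stepB n) (stepA n).
Proof.
elim: n => [|n [z hz]].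
  by exists (fun _ => 0); split=> //; rewrite /stepA /stepB /stepC hyp_poly0 /root_prod big_geq.
have [z1 hz1] := interlaced_step (coefCA_gt0 n) hz.
rewrite dvdn_mulr// stepC_A addrK in hz1.
have [z2 hz2] := interlaced_step (coefAB_gt0 n) hz1.
rewrite ifF ?stepA_B ?addrK in hz2; last by lia.
have [z3 hz3] := interlaced_step (coefBC_gt0 n) hz2.
rewrite ifF ?stepB_C ?addrK in hz3; last by lia.
by exists z3; rewrite mulnS -stepB_C -stepA_B in hz3 *.
Qed.

Lemma stepA_zeros n : exists s : seq R, [/\ size s = n, uniq s &
    forall x, x \in s -> [/\ 0 < x, root (stepA n) x & mup x (stepA n) = 1%N]].
Proof.
case: n => [|n]; first by exists [::].
have [z hz] := interlaced_steps n.
have [z1 hz1] := interlaced_step (coefCA_gt0 n) hz.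
rewrite dvdn_mulr// stepC_A addrK in hz1.
have [s [ss us hs]] := interlaced_zeros hz1.
by exists s; split => //; rewrite ss; lia.
Qed.

(** Value 0 at 0 stands for the absent polynomials of degree -1. *)
Definition delayed (f : nat -> R) n : R := if n is n'.+1 then f n' else 0.

Definition rec_beta n := delayed coefAB n + delayed coefBC n + coefCA n.
Definition rec_alpha n := (delayed coefAB n + delayed coefBC n) * coefCA n.-1 +
  delayed coefAB n * delayed coefBC n.-1.
Definition rec_gamma n := delayed coefAB n * delayed coefBC n.-1 * coefCA n.-2.

(** Multiply A_n = C_n + (l_n + l'_n) C_(n-1) + l_n l'_(n-1) C_(n-2) by x and express
    each x C_j by A_(j+1) and A_j.  At n = 0 and n = 1 the vanishing of delayed coefficients
    removes the terms with negative index. *)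
Lemma stepA_rec x n : (stepA n.+1).[x] = (x - rec_beta n) * (stepA n).[x] -
  rec_alpha n * (stepA n.-1).[x] - rec_gamma n * (stepA n.-2).[x].
Proof.
have hA m : (stepA m.+1).[x] = (stepB m.+1).[x] + coefAB m * (stepB m).[x].
  by rewrite stepA_B hornerD hornerZ.
have hB m : (stepB m.+1).[x] = (stepC m.+1).[x] + coefBC m * (stepC m).[x].
  by rewrite stepB_C hornerD hornerZ.
have hC m : x * (stepC m).[x] = (stepA m.+1).[x] + coefCA m * (stepA m).[x].
  have := congr1 (horner^~ x) (stepC_A m).
  by rewrite /= hornerM hornerX hornerD hornerZ.
have A0 : stepA 0 = 1 by exact: hyp_poly0.
have B0 : stepB 0 = 1 by exact: hyp_poly0.
have C0 : stepC 0 = 1 by exact: hyp_poly0.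
rewrite /rec_beta /rec_alpha /rec_gamma; apply: (addIr (coefCA n * (stepA n).[x])).
rewrite -hC; case: n => [|[|n]] /=.
- by rewrite A0 C0 hornerC; ring.
- have key : x * (stepC 1).[x] = x * (stepA 1).[x] -
      (coefAB 0 + coefBC 0) * (x * (stepC 0).[x]).
    by rewrite hA hB B0 C0 hornerC; ring.
  by rewrite key !hC; ring.
- have key : x * (stepC n.+2).[x] = x * (stepA n.+2).[x] -
      (coefAB n.+1 + coefBC n.+1) * (x * (stepC n.+1).[x]) -
      coefAB n.+1 * coefBC n * (x * (stepC n).[x]).
    by rewrite hA !hB; ring.
  by rewrite key !hC; ring.
Qed.

Lemma eparam_half m n : (n <= m <= n.+2)%N ->
  `|eparam m - n.+1%:R / 2| <= g + d%:R + 2.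
Proof.
move=> /andP[h1 h2].
have e := odd_double_half (m + d); rewrite -mul2n in e.
have {}e : (odd (m + d))%:R + 2 * ((m + d)./2)%:R = m%:R + d%:R :> R.
  by rewrite -natrM -!natrD e.
have o1 : (odd (m + d))%:R <= 1 :> R by case: (odd _).
have o0 : 0 <= (odd (m + d))%:R :> R by [].
have m1 : n%:R <= m%:R :> R by rewrite ler_nat.
have m2 : m%:R <= n%:R + 2 :> R by rewrite -natrD ler_nat addn2.
have d0 : 0 <= d%:R :> R by [].
have gp := g0.
rewrite /eparam -natr1 ler_norml; apply/andP; split; lra.
Qed.

(** The two possible growth rates of the step coefficients, with and without a
    jump of the parameter e. *)
Definition slope (j : bool) : R := if j then 2 / 9 else 2 / 3.

Lemma slope_ge0 j : 0 <= slope j. Proof. by case: j; rewrite /slope divr_ge0. Qed.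

(** One constant k for all three steps, so that products of these bounds are
    multiples of powers of n + k. *)
Lemma step_coefs_linear : exists2 k : R, 0 < k & forall n,
  [/\ delayed coefAB n <= slope (jump n) * (n%:R + k),
     delayed coefBC n <= slope (~~ jump n) * (n%:R + k) &
     coefCA n <= slope (jump n) * (n%:R + k)].
Proof.
have G0 : 0 <= g + d%:R + 2 :> R by rewrite !addr_ge0// ltW// g0.
have a11 : -1 < a + 1 by rewrite (lt_trans a1)// ltrDl.
have [k1 k10 h1] := quotient_linear_bound g0 G0 (ltrN10 R) b1.
have [k2 k20 h2] := quotient_linear_bound g0 G0 (ltrN10 R) a11.
have [k3 k30 h3] := quotient_linear_bound g0 G0 a1 b1.
have bound j h p q k m n : 0 <= h -> -1 < p -> -1 < q -> (n <= m <= n.+2)%N ->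
    (forall n E, g <= E -> `|E - n.+1%:R / 2| <= g + d%:R + 2 ->
    (p + n.+1%:R) * (q + n.+1%:R) / (E + n%:R) <= 2 / 3 * (n.+1%:R + k) /\
    (p + n.+1%:R) * (q + n.+1%:R) / (E + n%:R) * (E / (E + n.+1%:R)) <=
      2 / 9 * (n.+1%:R + k)) -> step_coef j h p q (eparam m) n <= slope j * (n.+1%:R + k).
  move=> h0 p1 q1 hm H; have [H1 H2] := H n (eparam m) (eparam_ge m) (eparam_half hm).
  rewrite /step_coef /slope; case: j; last by rewrite mulr1.
  apply: le_trans H2; rewrite ler_wpM2l//.
    apply: divr_ge0; last by rewrite addr_ge0// ltW// eparam_gt0.
    by apply: mulr_ge0; exact: addS_ge0.
  rewrite ler_wpM2r ?gerBl// invr_ge0 ltW// addr_gt0//.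
  exact: eparam_gt0.
pose k := k1 + k2 + k3 + 1.
have k0 : 0 < k by rewrite /k ltr_wpDl// !addr_ge0.
have a10 : 0 <= a + 1 by rewrite -lerBlDr sub0r ltW.
have b10 : 0 <= b + 1 by rewrite -lerBlDr sub0r ltW.
exists k => // n; split.
- case: n => [|n]; first by rewrite mulr_ge0 ?slope_ge0// addr_ge0// ltW.
  apply: le_trans (bound (jump n.+1) (a + 1) 0 b k1 n.+1 n a10 (ltrN10 R) b1 _ h1) _.
    by rewrite leqnSn ltnW.
  rewrite ler_wpM2l ?slope_ge0// lerD2l /k -!addrA lerDl !addr_ge0//.
- case: n => [|n]; first by rewrite mulr_ge0 ?slope_ge0// addr_ge0// ltW.
  rewrite jumpS negbK.
  apply: le_trans (bound (jump n) (b + 1) 0 (a + 1) k2 n.+2 n b10 (ltrN10 R) a11 _ h2) _.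
    by rewrite leqnn andbT -addn2 leq_addr.
  rewrite ler_wpM2l ?slope_ge0// lerD2l /k -!addrA ler_wpDl// lerDl !addr_ge0//.
- apply: le_trans (bound (jump n) 0 a b k3 n n (lexx 0) a1 b1 _ h3) _.
    by rewrite leqnn -addn2 leq_addr.
  rewrite ler_wpM2l ?slope_ge0// -natr1 -addrA lerD2l /k addrC lerD2r.
  by rewrite lerDr addr_ge0.
Qed.

Lemma delayed_ge0 (f : nat -> R) n : (forall i, 0 < f i) -> 0 <= delayed f n.
Proof. by move=> f0; case: n => //= n; exact: ltW. Qed.

(** The bounds 14/9, 52/81 and 8/27 are the larger values, over both parities, of
    the sums of products of slopes 2/9 and 2/3 in the recurrence
    coefficients. *)
Lemma stepA_gt0 (tau : R) : 0 < tau -> exists K : R, forall n x,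
  (tau + 14 / 9 + 52 / 81 / tau + 8 / 27 / tau ^+ 2) * n%:R + K <= x ->
  0 < (stepA n).[x].
Proof.
move=> tau0; have [k k0 hk] := step_coefs_linear.
set M := tau + _ + _ + _; exists (M * k) => N x hx.
have d1 n := delayed_ge0 n coefAB_gt0.
have d2 n := delayed_ge0 n coefBC_gt0.
have d3 n := ltW (coefCA_gt0 n).
have al0 n : 0 <= rec_alpha n by rewrite /rec_alpha addr_ge0// mulr_ge0// addr_ge0.
have ga0 n : 0 <= rec_gamma n by rewrite /rec_gamma mulr_ge0// mulr_ge0.
pose nu := N%:R + k; have nu0 : 0 < nu by rewrite ltr_wpDl.
apply: (@recurrence_growth _ (fun n => (stepA n).[x]) rec_beta rec_alpha rec_gamma x (tau * nu) N).
- by rewrite mulr_gt0.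
- by rewrite /stepA hyp_poly0 hornerC.
- exact: stepA_rec.
- by rewrite /rec_alpha /= addr0 !mul0r addr0.
- by rewrite /rec_gamma /= !mul0r.
- by rewrite /rec_gamma /= mulr0 mul0r.
- by [].
- by [].
move=> n lt_nN; apply: le_trans hx.
have le_nu m : (m <= n)%N -> m%:R + k <= nu.
  by move=> le_mn; rewrite lerD2r ler_nat (leq_trans le_mn)// ltnW.
have L1 m : (m <= n)%N -> delayed coefAB m <= slope (jump m) * nu.
  by move=> /le_nu le_m; have [h _ _] := hk m; rewrite (le_trans h)// ler_wpM2l ?slope_ge0.
have L2 m : (m <= n)%N -> delayed coefBC m <= slope (~~ jump m) * nu.
  by move=> /le_nu le_m; have [_ h _] := hk m; rewrite (le_trans h)// ler_wpM2l ?slope_ge0.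
have L3 m : (m <= n)%N -> coefCA m <= slope (jump m) * nu.
  by move=> /le_nu le_m; have [_ _ h] := hk m; rewrite (le_trans h)// ler_wpM2l ?slope_ge0.
have hbe : rec_beta n <= 14 / 9 * nu.
  rewrite /rec_beta; have := L1 n (leqnn n); have := L2 n (leqnn n); have := L3 n (leqnn n).
  by rewrite /slope; case: (jump n) => /=; lra.
have hal : rec_alpha n <= 52 / 81 * nu ^+ 2.
  rewrite /rec_alpha; case: (n) L1 L2 L3 => [|m] L1 L2 L3.
    by rewrite /= addr0 !mul0r addr0 mulr_ge0 ?divr_ge0 ?exprn_ge0// ltW.
  have l1 := L1 m.+1 (leqnn _); have l2 := L2 m.+1 (leqnn _).
  have l3 := L3 m (leqnSn _); have l4 := L2 m (leqnSn _); rewrite jumpS in l1 l2.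
  rewrite [m.+1.-1]/=.
  have p1 : (delayed coefAB m.+1 + delayed coefBC m.+1) * coefCA m <=
      (slope (~~ jump m) * nu + slope (~~ ~~ jump m) * nu) * (slope (jump m) * nu).
    by apply: ler_pM; rewrite ?addr_ge0// lerD.
  have p2 : delayed coefAB m.+1 * delayed coefBC m <=
      slope (~~ jump m) * nu * (slope (~~ jump m) * nu) by apply: ler_pM.
  apply: le_trans (lerD p1 p2) _; rewrite /slope expr2.
  by case: (jump m) => /=; lra.
have hga : rec_gamma n <= 8 / 27 * nu ^+ 3.
  rewrite /rec_gamma; case: (n) L1 L2 L3 => [|[|m]] L1 L2 L3.
  - by rewrite /= !mul0r mulr_ge0 ?divr_ge0 ?exprn_ge0// ltW.
  - by rewrite /= mulr0 mul0r mulr_ge0 ?divr_ge0 ?exprn_ge0// ltW.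
  have l1 := L1 m.+2 (leqnn _); have l2 := L2 m.+1 (leqnSn _).
  have l3 := L3 m (leqW (leqnSn _)); rewrite !jumpS negbK in l1 l2.
  rewrite [m.+2.-1]/= [m.+2.-2]/=.
  have p1 : delayed coefAB m.+2 * delayed coefBC m.+1 <=
      slope (jump m) * nu * (slope (jump m) * nu) by apply: ler_pM.
  have p2 : delayed coefAB m.+2 * delayed coefBC m.+1 * coefCA m <=
      slope (jump m) * nu * (slope (jump m) * nu) * (slope (jump m) * nu).
    by apply: ler_pM => //; rewrite mulr_ge0.
  apply: le_trans p2 _.
  have -> : slope (jump m) * nu * (slope (jump m) * nu) * (slope (jump m) * nu) =
    slope (jump m) ^+ 3 * nu ^+ 3 by ring.
  rewrite ler_wpM2r ?exprn_ge0 ?(ltW nu0)//.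
  by rewrite /slope; case: (jump m); lra.
have T0 : 0 < tau * nu by rewrite mulr_gt0.
have -> : M * N%:R + M * k = tau * nu + 14 / 9 * nu + 52 / 81 * nu ^+ 2 / (tau * nu) +
    8 / 27 * nu ^+ 3 / (tau * nu) ^+ 2.
  rewrite -mulrDr -/nu /M; field.
  by rewrite !gt_eqF.
apply: lerD; last by rewrite ler_wpM2r ?invr_ge0 ?exprn_ge0 ?(ltW T0).
apply: lerD; last by rewrite ler_wpM2r ?invr_ge0 ?(ltW T0).
by rewrite lerD2l.
Qed.

End StepLine.

(** * The constant and the largest zero *)

Section Constant.
Variable R : realType.

Lemma cube_root_powR (x : R) : 0 <= x -> (x `^ 3%:R^-1) ^+ 3 = x.
Proof. by move=> x0; rewrite -powR_mulrn ?powR_ge0// -powRrM mulVf// powRr1. Qed.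

Lemma DeltaM_val : DeltaM R = 1119104%:R / 14348907%:R.
Proof. by rewrite /DeltaM /gammaM /alphaM; field. Qed.

Lemma DeltaM_gt0 : 0 < DeltaM R.
Proof. by rewrite DeltaM_val divr_gt0. Qed.

(** Cardano's formula: the two cube roots have product alphaM / 3. *)
Lemma tauM_cubic : 0 < tauM R /\ tauM R ^+ 3 = alphaM R * tauM R + 2 * gammaM R.
Proof.
have s2 : Num.sqrt (DeltaM R) ^+ 2 = gammaM R ^+ 2 - (alphaM R / 3) ^+ 3.
  rewrite sqr_sqrtr ?(ltW DeltaM_gt0)// /DeltaM; congr (_ - _).
  by field.
have s0 : 0 <= Num.sqrt (DeltaM R) by exact: sqrtr_ge0.
have al0 : 0 < alphaM R by rewrite /alphaM divr_gt0.
have ga0 : 0 < gammaM R by rewrite /gammaM divr_gt0.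
have sg : Num.sqrt (DeltaM R) < gammaM R.
  rewrite -(@ltr_pXn2r _ 2)// ?nnegrE ?(ltW ga0)// s2.
  by rewrite gtrBl exprn_gt0// divr_gt0.
rewrite /tauM; set s := Num.sqrt _ in s2 s0 sg *.
have p1 : 0 < gammaM R + s by rewrite ltr_wpDr.
have p2 : 0 < gammaM R - s by rewrite subr_gt0.
have u3 := cube_root_powR (ltW p1); have v3 := cube_root_powR (ltW p2).
have uv : (gammaM R + s) `^ 3%:R^-1 * (gammaM R - s) `^ 3%:R^-1 = alphaM R / 3.
  rewrite -powRM ?(ltW p1) ?(ltW p2)//.
  have -> : (gammaM R + s) * (gammaM R - s) = gammaM R ^+ 2 - s ^+ 2 by ring.
  rewrite s2 subKr -powR_mulrn ?divr_ge0 ?(ltW al0)// -powRrM mulfV// powRr1//.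
  by rewrite divr_ge0 ?(ltW al0).
split; first by rewrite addr_gt0// powR_gt0.
move: u3 v3 uv; set u := _ `^ _; set v := _ `^ _ => u3 v3 uv.
have -> : (u + v) ^+ 3 = u ^+ 3 + v ^+ 3 + 3 * (u * v) * (u + v) by ring.
by rewrite u3 v3 uv; field.
Qed.

(** The cubic equation eliminates gammaM from the minimum of
    tau + 14/9 + (52/81)/tau + (8/27)/tau^2. *)
Lemma constM_alt : constM R = tauM R + 14 / 9 + 52 / 81 / tauM R + 8 / 27 / tauM R ^+ 2.
Proof.
have [t0 t3] := tauM_cubic; have t0' : tauM R != 0 by rewrite gt_eqF.
have -> : 8 / 27 / tauM R ^+ 2 = gammaM R / tauM R ^+ 2 by [].
have -> : gammaM R = (tauM R ^+ 3 - alphaM R * tauM R) / 2 by rewrite t3; field.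
by rewrite /constM /betaM /alphaM; field.
Qed.

Lemma constM_approx : `|constM R - 3484%:R / 1000%:R| < 2000%:R^-1.
Proof.
have [t0 t3] := tauM_cubic; rewrite /constM /betaM; move: t3; rewrite /alphaM /gammaM.
set t := tauM R in t0 *; move=> t3.
have t3' : t * (t * t) = 52 / 81 * t + 2 * (8 / 27) by rewrite -t3; ring.
(* The interval [49/45, 61/56] around tau has length less than 0.0004, while
   the constant varies by about 1.23 times as much. *)
have lo : 49 / 45 <= t.
  rewrite leNgt; apply/negP => ht.
  have h2 : t * t <= 49 / 45 * (49 / 45) by apply: ler_pM; lra.
  have h3 : t * (t * t) <= t * (49 / 45 * (49 / 45)) by rewrite ler_pM2l.
  by lra.
have hi : t <= 61 / 56.
  rewrite leNgt; apply/negP => ht.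
  have h2 : 61 / 56 * (61 / 56) <= t * t by apply: ler_pM; lra.
  have h3 : t * (61 / 56 * (61 / 56)) <= t * (t * t) by rewrite ler_pM2l.
  by lra.
have hv : t * t^-1 = 1 by rewrite mulfV// gt_eqF.
have v0 : 0 < t^-1 by rewrite invr_gt0.
have -> : 52%:R / 81%:R / (2%:R * t) = 26 / 81 * t^-1 by field; rewrite gt_eqF.
have vhi : 49 / 45 * t^-1 <= 1 by rewrite -[leRHS]hv ler_pM2r.
have vlo : 1 <= 61 / 56 * t^-1 by rewrite -[leLHS]hv ler_pM2r.
by rewrite ltr_norml; apply/andP; split; lra.
Qed.

End Constant.

Lemma eqo_cst_natr (R : realType) (K : R) :
  (fun _ : nat => K : R^o) =o_\oo (fun n => n%:R : R^o).
Proof.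
apply/eqoP => eps eps0; near=> n.
rewrite [`|n%:R|]ger0_norm// -ler_pdivrMl// mulrC.
by near: n; exact: nbhs_infty_ger.
Unshelve. all: by end_near. Qed.

(** With N = floor((n+d)/2) - d, the parameter e = c+b+1+floor((n+d)/2) of stepA n
    exceeds by N the one of the moments of the first weight, with c + d for c;
    with 1 - d for d this holds for the second weight. *)
Lemma step_line_first n k d : (d < 2)%N -> (2 * k + 1 <= n)%N ->
  [/\ (d <= (n + d)./2)%N, (k <= (n + d)./2 - d)%N & (k + ((n + d)./2 - d) < n)%N].
Proof. by move=> hd hk; split; lia. Qed.

Lemma step_line_second n k d : (d < 2)%N -> (2 * k + 2 <= n)%N ->
  [/\ (d <= 1)%N, (1 - d <= (n + d)./2)%N, (k <= (n + d)./2 - (1 - d))%N &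
     (k + ((n + d)./2 - (1 - d)) < n)%N].
Proof. by move=> hd hk; split; lia. Qed.

Section Identification.
Variable R : realType.
Variables (a b c : R) (d : 'I_2) (P : nat -> {poly R}).
Hypotheses (a1 : -1 < a) (b1 : -1 < b) (hc : Num.max 0 (a - b) < c).
Hypothesis Pmonic : forall n, P n \is monic.
Hypothesis Porth : two_orthogonal (weight_vec d a b c) P.

Lemma two_orthogonal_stepA n : P n = stepA a b (c + b + 1) d n.
Proof.
have c0 : 0 < c by apply: le_lt_trans hc; rewrite le_max lexx.
have [sP o1 n1 o2 n2] := Porth.
have d2 : (d < 2)%N by [].
have [dr0 dr1] : 0 <= (d : nat)%:R :> R /\ (d : nat)%:R <= 1 :> R.
  by split; rewrite ?ler0n// lern1.
have c1 : 0 < c + d%:R by rewrite ltr_wpDr.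
have c2 : 0 < c + 1 - d%:R by rewrite -addrA ltr_wpDr// subr_ge0.
have ip c' k p : 0 < c' ->
    integral_pos (fun x => x ^+ k * p.[x] * weightW a b c' x) =
    moment_functional (weight_moment a b c') k p.
  by move=> c'0; exact: integral_poly_weight.
have van c' k N : 0 < c' -> c' + b + 1 + N%:R = eparam (c + b + 1) d n -> (k <= N)%N ->
    (k + N < n)%N ->
    moment_functional (weight_moment a b c') k (stepA a b (c + b + 1) d n) = 0.
  move=> c'0 e kN kn; rewrite /stepA -e; apply: moment_functional_hyp_poly => //.
    by rewrite -addrA addr_gt0// -ltrBlDr sub0r.
  by move=> i; exact: weight_moment_rec.
apply: (@two_orthogonal_unique _ (weight_moment a b (c + d%:R))
   (weight_moment a b (c + 1 - d%:R))) => //.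
- by move=> k i h; rewrite -ip//; exact: o1.
- by move=> k; rewrite -ip//; exact: n1.
- by move=> k i h; rewrite -ip//; exact: o2.
- by move=> k; rewrite -ip//; exact: n2.
- exact: size_hyp_poly.
- exact: monic_hyp_poly.
- move=> k /(step_line_first d2)[h1 h2 h3].
  apply: (van _ _ ((n + d)./2 - d)%N) => //.
  by rewrite natrB// /eparam; ring.
- move=> k /(step_line_second d2)[h0 h1 h2 h3].
  apply: (van _ _ ((n + d)./2 - (1 - d))%N) => //.
  by rewrite !natrB// /eparam; ring.
Qed.

End Identification.

Theorem corollary3p6 (R : realType) (a b c : R)
    (ha : -1 < a) (hb : -1 < b) (hc : Num.max 0 (a - b) < c)
    (d : 'I_2) (P : nat -> {poly R})
    (Pmonic : forall n, P n \is monic)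
    (Porth : two_orthogonal (weight_vec d a b c) P) :
  [/\ forall n, has_simple_positive_zeros n (P n),
      forall x : nat -> R,
        (forall n, (0 < n)%N -> is_largest_zero (P n) (x n)) ->
        exists e : nat -> R^o,
          e =o_\oo (fun n => n%:R : R^o) /\
          \forall n \near \oo, x n < constM R * n%:R + e n,
      DeltaM R = 1119104%:R / 14348907%:R,
      0 < DeltaM R &
      `|constM R - 3484%:R / 1000%:R| < 2000%:R^-1].
Proof.
have PE := two_orthogonal_stepA ha hb hc Pmonic Porth.
have ag : a + 1 < c + b + 1.
  have : a - b < c by apply: le_lt_trans hc; rewrite le_max lexx orbT.
  by lra.
have bg : b + 1 < c + b + 1.
  have : 0 < c by apply: le_lt_trans hc; rewrite le_max lexx.
  by lra.
split; [| |exact: DeltaM_val|exact: DeltaM_gt0|exact: constM_approx].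
  by move=> n; rewrite PE; exact: stepA_zeros.
move=> x hx; have [K hK] := stepA_gt0 d ha hb ag bg (tauM_cubic R).1.
exists (fun _ => K); split; first exact: eqo_cst_natr.
near=> n; have n0 : (0 < n)%N by near: n; exact: nbhs_infty_gt.
rewrite ltNge; apply/negP => hn.
have := hK n (x n); rewrite -constM_alt => /(_ hn).
have [/rootP rx _] := hx n n0.
by rewrite -PE rx ltxx.
Unshelve. all: by end_near. Qed.
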